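(* Let $\mathcal{F}$ be a hereditary family of finite subsets of $\mathbb{N}$ covering $\mathbb{N}$. Regard $X_{\mathcal{F}}\subseteq X_{\mathcal{F}}^{**}$ canonically and consider the weak$^*$ topology on $X_{\mathcal{F}}^{**}$. The following are equivalent: (0) $\mathcal{F}$ and $\mathcal{F}^\perp$ are geometric duals. (1) $\mathrm{Ext}(B(X_{\mathcal{F}\upharpoonright V}))=W(\max(\mathcal{F}^\perp\upharpoonright V))$ for every non-empty finite $V\subseteq\mathbb{N}$. (2) $B(X_{\mathcal{F}})\cap c_{00}=\mathrm{conv}(W(\mathcal{F}^\perp))$. (3) $B(X_{\mathcal{F}})=\overline{\mathrm{conv}}^{\|\cdot\|_{\mathcal{F}}}(W(\mathcal{F}^\perp))$ (norm-closed convex hull). (4) $B(X_{\mathcal{F}}^{**})=\overline{\mathrm{conv}}^{w^*}(W(\mathcal{F}^\perp))$ (weak$^*$-closed convex hull in $X_{\mathcal{F}}^{**}$). (5) $\mathcal{F}=\mathcal{C}(G)$ for some perfect graph $G$ on $\mathbb{N}$.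
   Context: $\mathbb{N}=\{1,2,\dots\}$. For a non-empty countable (possibly finite) set $\Omega$ and a hereditary family $\mathcal{F}$ of finite subsets of $\Omega$ with $\bigcup\mathcal{F}=\Omega$ (hereditary: $E\subseteq F\in\mathcal{F}\Rightarrow E\in\mathcal{F}$), put $\|x\|_{\mathcal{F}}=\sup\{\sum_{i\in F}|x(i)|:F\in\mathcal{F}\}$ for $x\in\mathbb{R}^\Omega$, $Y_{\mathcal{F}}=\{x\in\mathbb{R}^\Omega:\|x\|_{\mathcal{F}}<\infty\}$, and $X_{\mathcal{F}}=\{x\in\mathbb{R}^\Omega:\inf\{\|P_{\Omega\setminus E}(x)\|_{\mathcal{F}}:E\subseteq\Omega\text{ finite}\}=0\}$, where $P_A(x)$ agrees with $x$ on $A$ and is $0$ off $A$. With $\|\cdot\|_{\mathcal{F}}$ these are Banach spaces; $X_{\mathcal{F}}$ is the completion of the space $c_{00}$ of finitely supported sequences, with the unit vectors $(e_n)$ as 1-unconditional basis. The dual $X_{\mathcal{F}}^*$ (with dual norm) is regarded as a subset of $\mathbb{R}^\Omega$ via $\alpha\mapsto(\alpha(e_n))_n$. For $\Omega=\mathbb{N}$: $\mathcal{F}^\perp$ is the family of all finite $E\subseteq\mathbb{N}$ with $|E\cap F|\le1$ for every $F\in\mathcal{F}$; it is again hereditary and covers $\mathbb{N}$. $\mathcal{F}$ is the geometric dual of $\mathcal{H}$ if $Y_{\mathcal{F}}=X_{\mathcal{H}}^*$ as subsets of $\mathbb{R}^{\mathbb{N}}$ with equal norms; $\mathcal{F}$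 and $\mathcal{H}$ are geometric duals if each is the geometric dual of the other. For non-empty $V\subseteq\mathbb{N}$, $\mathcal{F}\upharpoonright V=\{F\in\mathcal{F}:F\subseteq V\}$, viewed as a family on $V$. For a family $\mathcal{H}$ of subsets of $\Omega$, $W(\mathcal{H})=\{\sigma\in\{-1,0,1\}^{\Omega}:\mathrm{supp}(\sigma)\in\mathcal{H}\}$, and $\max(\mathcal{H})$ is the set of $\subseteq$-maximal elements of $\mathcal{H}$. $B(X)$ is the closed unit ball of $X$, $\mathrm{Ext}$ denotes the set of extreme points, $\mathrm{conv}$ the convex hull. For a simple graph $G$, $\mathcal{C}(G)$ is the family of its finite cliques (finite sets of pairwise adjacent vertices, including $\emptyset$ and singletons). $G=(V,E)$ is perfect if for every finite $H\subseteq V$ the induced subgraph $G\upharpoonright H$ has chromatic number equal to its clique number. *)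

(* Defs.v *)
From HB Require Import structures.
From mathcomp Require Import all_boot all_order all_algebra finmap.
From mathcomp Require Import all_classical all_reals all_analysis.

Set Implicit Arguments.
Unset Strict Implicit.
Unset Printing Implicit Defensive.

Import Order.TTheory GRing.Theory Num.Theory.
Import numFieldNormedType.Exports.

Local Open Scope classical_set_scope.
Local Open Scope ring_scope.

Section Convexity.
Context {R : realType} {E : lmodType R}.
Implicit Types (A : set E) (x y z : E).

Definition conv_hull A : set E := smallest (@convex_set R E) A.

Definition extreme_points A : set E :=
  [set x | A x /\ forall y z (t : R), A y -> A z -> 0 < t < 1 ->
    x = t *: y + (1 - t) *: z -> y = z].

End Convexity.

Definition unit_ball {R : realType} (V : normedModType R) : set V :=
  [set x | `|x| <= 1].
Arguments unit_ball {R} V.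

Section Dual.
Context {R : realType} (V : normedModType R).
Implicit Types (f : V -> R^o).

Definition is_functional : {pred V -> R^o} :=
  fun f => `[< linear f /\ continuous f >].

(* A record instead of a sig type: functions carry a uniform structure, from
   which a sig type would inherit a topology that is not the one of the norm. *)
Record dual := Dual { functional :> V -> R^o ; _ : is_functional functional }.

HB.instance Definition _ := [isSub for functional].
HB.instance Definition _ := [Choice of dual by <:].

Lemma is_functionalP f : reflect (linear f /\ continuous f) (f \in is_functional).
Proof. exact: asboolP. Qed.

Lemma is_functional_submod : submod_closed is_functional.
Proof.
split=> [|a f g Hf Hg]; apply/is_functionalP.
  split=> [c x y|x]; last exact: cvg_cst.
  by rewrite [RHS]addr0 [RHS]scaler0.
have [lf cf] := is_functionalP f Hf; have [lg cg] := is_functionalP g Hg.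
split=> [c x y|x].
  rewrite !fctE lf lg !scalerDr -!addrA; congr (_ + _).
    by rewrite !scalerA mulrC.
  by rewrite addrCA.
by apply: cvgD; [apply: cvgZr; exact: cf|exact: cg].
Qed.

HB.instance Definition _ :=
  GRing.isSubmodClosed.Build R (V -> R^o) is_functional is_functional_submod.
HB.instance Definition _ := [SubChoice_isSubLmodule of dual by <:].

Lemma dual_linear (f : dual) : linear f.
Proof. by case: f => f Hf; have [] := is_functionalP f Hf. Qed.

Lemma dual_continuous (f : dual) : continuous f.
Proof. by case: f => f Hf; have [] := is_functionalP f Hf. Qed.

HB.instance Definition _ (f : dual) :=
  GRing.isLinear.Build R V R^o _ f (dual_linear f).

Definition dual_norm (f : dual) : R :=
  sup [set `|f x| | x in unit_ball V].

Lemma dual_norm_has_sup (f : dual) :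
  has_sup [set `|f x| | x in unit_ball V].
Proof.
split; first by exists `|f 0|, 0 => //; rewrite /unit_ball /= normr0.
have /linear_bounded_continuous/bounded_funP/(_ 1)[M fM] : continuous (f : V -> R^o).
  exact: dual_continuous.
by exists M => _ [x x1 <-]; exact: fM.
Qed.

Lemma dual_norm_ub (f : dual) (x : V) : `|f x| <= dual_norm f * `|x|.
Proof.
have [->|x0] := eqVneq x 0; first by rewrite linear0 !normr0 mulr0.
rewrite -ler_pdivrMr ?normr_gt0//.
apply: (sup_upper_bound (dual_norm_has_sup f)).
exists (`|x|^-1 *: x); first by rewrite /unit_ball /= normfZV.
by rewrite linearZ /= normrM normfV normr_id mulrC.
Qed.

Lemma dual_norm_le (f : dual) (M : R) :
  (forall x, `|x| <= 1 -> `|f x| <= M) -> dual_norm f <= M.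
Proof.
move=> fM; apply: ge_sup; first by case: (dual_norm_has_sup f).
by move=> _ [x x1 <-]; exact: fM.
Qed.

Lemma dual_normD (f g : dual) : dual_norm (f + g) <= dual_norm f + dual_norm g.
Proof.
apply: dual_norm_le => x x1; apply: le_trans (ler_normD _ _) _.
by apply: lerD; apply: (sup_upper_bound (dual_norm_has_sup _)); exists x.
Qed.

Lemma dual_normZ_le (a : R) (f : dual) : dual_norm (a *: f) <= `|a| * dual_norm f.
Proof.
apply: dual_norm_le => x x1; rewrite [X in X <= _]normrM ler_wpM2l//.
by apply: (sup_upper_bound (dual_norm_has_sup _)); exists x.
Qed.

Lemma dual_normZ (a : R) (f : dual) : dual_norm (a *: f) = `|a| * dual_norm f.
Proof.
have [->|a0] := eqVneq a 0.
  rewrite scale0r normr0 mul0r; apply/le_anti/andP; split.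
    by apply: dual_norm_le => x _; rewrite normr0.
  apply: (sup_upper_bound (dual_norm_has_sup _)).
  by exists 0; rewrite /unit_ball /= normr0.
apply/le_anti/andP; split; first exact: dual_normZ_le.
rewrite -ler_pdivlMl ?normr_gt0//.
rewrite -[X in dual_norm X <= _](scalerK a0); apply: le_trans (dual_normZ_le _ _) _.
by rewrite normfV.
Qed.

Lemma dual_norm_eq0 (f : dual) : dual_norm f = 0 -> f = 0.
Proof.
move=> f0; apply/val_inj/funext => x /=.
by apply/eqP; rewrite -normr_le0 (le_trans (dual_norm_ub f x))// f0 mul0r.
Qed.

HB.instance Definition _ :=
  Lmodule_isNormed.Build R dual dual_normD dual_normZ dual_norm_eq0.

(* The weak* topology of the dual: the topology of pointwise convergence. *)
Definition weak_star : Type :=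
  initial_topology (functional : dual -> {ptws V -> R^o}).
HB.instance Definition _ := Topological.on weak_star.

Definition weak_star_closure (A : set dual) : set dual :=
  @closure weak_star A.

End Dual.

Section Bidual.
Context {R : realType} (V : normedModType R).

Lemma eval_is_functional (x : V) : is_functional (fun f : dual V => f x).
Proof.
apply/is_functionalP; split; first by [].
pose ev : {linear dual V -> R^o} :=
  HB.pack (fun f : dual V => f x : R^o)
    (GRing.isLinear.Build R (dual V) R^o _ (fun f : dual V => f x : R^o)
      (fun a f g => erefl)).
apply: (@bounded_linear_continuous _ _ _ ev).
apply/linear_boundedP; near=> r => f; apply: le_trans (dual_norm_ub f x) _.
by rewrite mulrC ler_wpM2r ?(normr_ge0 f)//; near: r; apply: nbhs_pinfty_ge; exact: num_real.
Unshelve. all: by end_near. Qed.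

Definition canonical_embedding (x : V) : dual (dual V) :=
  Dual (eval_is_functional x).

End Bidual.

Local Open Scope fset_scope.
Local Open Scope ring_scope.

Record covering_family (T : choiceType) := CoveringFamily {
  members :> {fset T} -> Prop ;
  carrier_neq0 : [set: T] !=set0 ;
  members_hereditary : forall E F, E `<=` F -> members F -> members E ;
  members_cover : forall i, exists2 F, members F & i \in F }.

Section Spaces.
Context (R : realType) (T : choiceType) (F : covering_family T).
Implicit Types (x y : T -> R^o).

Definition family_norm x : \bar R :=
  ereal_sup [set (\sum_(i <- A) `|x i|)%:E | A in members F].

Definition Yset : set (T -> R^o) := [set x | (family_norm x < +oo)%E].

Definition coord_proj (A : set T) x : T -> R^o := fun i => if i \in A then x i else 0.

Definition Xset : set (T -> R^o) :=
  [set x | ereal_inf [set family_norm (coord_proj (~` [set` E]) x) | E in [set: {fset T}]]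
           = 0%E].

Lemma family_norm_ub x (A : {fset T}) :
  F A -> ((\sum_(i <- A) `|x i|)%:E <= family_norm x)%E.
Proof. by move=> FA; apply: ereal_sup_ubound; exists A. Qed.

Lemma family_norm_le x (M : \bar R) :
  (forall A, F A -> ((\sum_(i <- A) `|x i|)%:E <= M)%E) -> (family_norm x <= M)%E.
Proof. by move=> xM; apply: ge_ereal_sup => _ [A FA <-]; exact: xM. Qed.

Lemma family_norm_ge0 x : (0 <= family_norm x)%E.
Proof.
have [i _] := carrier_neq0 F; have [A FA _] := members_cover F i.
by apply: le_trans (family_norm_ub x FA); rewrite lee_fin sumr_ge0.
Qed.

Lemma family_normD x y : (family_norm (x + y)%R <= family_norm x + family_norm y)%E.
Proof.
apply: family_norm_le => A FA.
apply: le_trans (leeD (family_norm_ub x FA) (family_norm_ub y FA)).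
by rewrite -EFinD lee_fin -big_split /= ler_sum// => i _; exact: ler_normD.
Qed.

Lemma family_normZ_le (a : R) x :
  (family_norm (a *: x)%R <= `|a|%:E * family_norm x)%E.
Proof.
apply: family_norm_le => A FA.
apply: le_trans (lee_wpmul2l _ (family_norm_ub x FA)); last by rewrite lee_fin.
rewrite -EFinM lee_fin mulr_sumr ler_sum// => i _.
by rewrite [X in X <= _]normrM.
Qed.

Lemma le_family_norm x y :
  (forall i, `|x i| <= `|y i|) -> (family_norm x <= family_norm y)%E.
Proof.
move=> xy; apply: family_norm_le => A FA; apply: le_trans (family_norm_ub y FA).
by rewrite lee_fin ler_sum.
Qed.

Lemma family_norm0 : family_norm (0 : T -> R^o) = 0%E.
Proof.
apply/le_anti; rewrite family_norm_ge0 andbT; apply: family_norm_le => A FA.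
by rewrite lee_fin big1// => i _; rewrite normr0.
Qed.

Lemma XsetP x : Xset x <-> forall e : R, 0 < e ->
  exists E : {fset T}, (family_norm (coord_proj (~` [set` E]) x) <= e%:E)%E.
Proof.
split=> [x0 e e0|xe].
  have : (ereal_inf [set family_norm (coord_proj (~` [set` E]) x) | E in [set: {fset T}]]
          < e%:E)%E by rewrite x0 lte_fin.
  by move=> /ereal_inf_lt[_ [E _ <-] /ltW xE]; exists E.
apply/le_anti/andP; split; last first.
  by apply: le_ereal_inf_tmp => _ [E _ <-]; exact: family_norm_ge0.
apply/lee_addgt0Pr => e /xe[E xE]; rewrite add0e; apply: le_trans xE.
by apply: ereal_inf_lbound; exists E.
Qed.

Lemma finite_support_Xset x : finite_set [set i | x i != 0] -> Xset x.
Proof.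
move=> /finite_fsetP[E xE]; apply/XsetP => e e0; exists E.
rewrite (_ : coord_proj _ _ = 0) ?family_norm0 ?lee_fin ?ltW//.
apply/funext => i; rewrite /coord_proj; case: ifPn => // /set_mem /= iE.
have [//|x0] := eqVneq (x i) 0.
by exfalso; apply: iE; have : [set` E] i by rewrite -xE.
Qed.

Lemma Xset_Yset x : Xset x -> Yset x.
Proof.
move=> /XsetP/(_ 1 ltr01)[E xE]; apply: (@le_lt_trans _ _ ((\sum_(i <- E) `|x i|)%:E + 1)%E).
  apply: family_norm_le => A FA.
  apply: le_trans (leeD (lexx _) xE).
  apply: le_trans (leeD (lexx _) (family_norm_ub _ FA)).
  rewrite -EFinD lee_fin (bigID (fun i => i \in E))/= lerD//.
    rewrite -big_filter [X in _ <= X](bigID (fun i => i \in A))/=.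
    rewrite -[X in _ <= X + _]big_filter -[X in X <= _]addr0 lerD ?sumr_ge0//.
    rewrite le_eqVlt; apply/orP; left; apply/eqP/perm_big/uniq_perm.
    - by rewrite filter_uniq ?fset_uniq.
    - by rewrite filter_uniq ?fset_uniq.
    by move=> i; rewrite !mem_filter andbC.
  rewrite big_mkcond/= ler_sum// => i _; case: ifPn => // iE.
  rewrite /coord_proj ifT// inE /=; exact/negP.
by rewrite -EFinD ltry.
Qed.

Definition is_Xvector : {pred T -> R^o} := fun x => x \in Xset.

Record Xspace := XSpace { coords :> T -> R^o ; _ : is_Xvector coords }.

HB.instance Definition _ := [isSub for coords].
HB.instance Definition _ := [Choice of Xspace by <:].

Lemma Xset_submod : submod_closed is_Xvector.
Proof.
split=> [|a x y].
  rewrite -[_ \in _]/(0 \in Xset) inE; apply: finite_support_Xset.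
  by apply: sub_finite_set (finite_set0 _) => i; rewrite /= eqxx.
rewrite -![_ \in is_Xvector]/(_ \in Xset) !inE => /XsetP xX /XsetP yX.
apply/XsetP => e e0.
have a1 : 0 < `|a| + 1 by rewrite ltr_wpDl.
have [A xA] := xX (e / 2 / (`|a| + 1)) (divr_gt0 (divr_gt0 e0 (ltr0Sn _ _)) a1).
have [B yB] := yX (e / 2) (divr_gt0 e0 (ltr0Sn _ _)).
exists (A `|` B).
have sub z (C : {fset T}) : C `<=` A `|` B ->
    (family_norm (coord_proj (~` [set` (A `|` B)]) z) <= family_norm (coord_proj (~` [set` C]) z))%E.
  move=> /fsubsetP CAB; apply: le_family_norm => i; rewrite /coord_proj.
  case: ifPn => [/set_mem /= iAB|]; last by rewrite normr0.
  by rewrite ifT// inE /= => iC; apply: iAB; exact: CAB.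
rewrite (_ : coord_proj _ _ = a *: coord_proj (~` [set` (A `|` B)]) x + coord_proj (~` [set` (A `|` B)]) y);
  last first.
  apply/funext => i; rewrite /coord_proj !fctE; case: ifP => // _.
  by rewrite scaler0 addr0.
apply: le_trans (family_normD _ _) _.
rewrite [e]splitr EFinD; apply: leeD; last first.
  by apply: le_trans yB; apply: sub; exact: fsubsetUr.
apply: le_trans (family_normZ_le _ _) _.
apply: (@le_trans _ _ (`|a|%:E * (e / 2 / (`|a| + 1))%:E)%E).
  apply: lee_wpmul2l; rewrite ?lee_fin//.
  by apply: le_trans xA; apply: sub; exact: fsubsetUl.
rewrite -EFinM lee_fin mulrCA ler_piMr ?divr_ge0 ?ltW//.
by rewrite ltr_pdivrMr// mul1r ltrDl.
Qed.

HB.instance Definition _ :=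
  GRing.isSubmodClosed.Build R (T -> R^o) is_Xvector Xset_submod.
HB.instance Definition _ := [SubChoice_isSubLmodule of Xspace by <:].

Definition Xnorm (x : Xspace) : R := fine (family_norm x).

Lemma XnormE (x : Xspace) : (Xnorm x)%:E = family_norm x.
Proof.
rewrite /Xnorm fineK// ge0_fin_numE ?family_norm_ge0//.
by case: x => x /set_mem /= /Xset_Yset.
Qed.

Lemma XnormD (x y : Xspace) : Xnorm (x + y) <= Xnorm x + Xnorm y.
Proof. by rewrite -lee_fin EFinD !XnormE; exact: family_normD. Qed.

Lemma XnormZ (a : R) (x : Xspace) : Xnorm (a *: x) = `|a| * Xnorm x.
Proof.
have le b (z : Xspace) : Xnorm (b *: z) <= `|b| * Xnorm z.
  by rewrite -lee_fin EFinM !XnormE; exact: family_normZ_le.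
apply/le_anti/andP; split; first exact: le.
have [->|a0] := eqVneq a 0.
  by rewrite normr0 mul0r -lee_fin XnormE family_norm_ge0.
rewrite -ler_pdivlMl ?normr_gt0// -normfV.
by rewrite -[X in Xnorm X <= _](scalerK a0).
Qed.

Lemma Xnorm_eq0 (x : Xspace) : Xnorm x = 0 -> x = 0.
Proof.
move=> x0; apply/val_inj/funext => i /=; have [A FA iA] := members_cover F i.
apply/eqP; rewrite -normr_le0 -x0 -lee_fin XnormE.
apply: le_trans (family_norm_ub x FA); rewrite lee_fin.
by rewrite (big_fsetD1 i iA)/= lerDl sumr_ge0.
Qed.

HB.instance Definition _ :=
  Lmodule_isNormed.Build R Xspace XnormD XnormZ Xnorm_eq0.

Lemma unit_vector_Xset (n : T) : is_Xvector (fun i => (i == n)%:R : R^o).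
Proof.
rewrite /is_Xvector inE; apply: finite_support_Xset.
apply: sub_finite_set (finite_set1 n) => i /=.
by have [->//|_] := eqVneq i n; rewrite mulr0n eqxx.
Qed.

Definition unit_vector (n : T) : Xspace := XSpace (unit_vector_Xset n).

Definition dual_coords (f : dual Xspace) : T -> R^o := fun n => f (unit_vector n).

End Spaces.

Definition c00 {R : realType} {T : Type} : set (T -> R^o) :=
  [set x | finite_set [set i | x i != 0]].

Definition geometric_dual (R : realType) (T : choiceType) (F H : covering_family T) :=
  Yset (R := R) F = range (@dual_coords R T H) /\
  forall f : dual (Xspace R H), family_norm F (dual_coords f) = `|f|%:E.

Definition geometric_duals (R : realType) (T : choiceType)
    (F H : covering_family T) :=
  geometric_dual R F H /\ geometric_dual R H F.

Section Perp.
Context {T : choiceType} (F : covering_family T).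

Definition perp_members : set {fset T} :=
  [set E | forall A, F A -> (#|` E `&` A| <= 1)%N].

Lemma perp_hereditary (E A : {fset T}) :
  E `<=` A -> perp_members A -> perp_members E.
Proof.
move=> EA pA B FB; apply: leq_trans (pA B FB).
by apply: fsubset_leq_card; exact: fsetSI.
Qed.

Lemma perp_cover (i : T) : exists2 E, perp_members E & i \in E.
Proof.
exists [fset i]; last by rewrite inE.
move=> A _; rewrite -(cardfs1 i).
by apply: fsubset_leq_card; exact: fsubsetIl.
Qed.

Definition perp : covering_family T :=
  CoveringFamily (carrier_neq0 F) perp_hereditary perp_cover.

End Perp.

Section Restriction.
Context {T : choiceType} (F : covering_family T) (V : {fset T}).
Hypothesis V0 : V != fset0.

(* The carrier of the restricted family is the subtype of the points of V, so
   its members are sets of points of V, seen in T through val. *)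
Definition restriction_members : set {fset V} :=
  [set A | F [fset val i | i in A]].

Lemma restriction_carrier : [set: V] !=set0.
Proof. by have /fset0Pn[i iV] := V0; exists [` iV]. Qed.

Lemma restriction_hereditary (E A : {fset V}) :
  E `<=` A -> restriction_members A -> restriction_members E.
Proof.
move=> /fsubsetP EA; apply: members_hereditary.
by apply/fsubsetP => _ /imfsetP[i /= iE ->]; apply/imfsetP; exists i => //; exact: EA.
Qed.

Lemma restriction_cover (i : V) : exists2 E, restriction_members E & i \in E.
Proof.
exists [fset i]; last by rewrite inE.
have [A FA iA] := members_cover F (val i).
apply: members_hereditary FA; apply/fsubsetP => _ /imfsetP[j /= + ->].
by rewrite inE => /eqP ->.
Qed.

Definition restriction : covering_family V :=
  CoveringFamily restriction_carrier restriction_hereditary restriction_cover.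

End Restriction.

Definition max_members {T : choiceType} (H : set {fset T}) : set {fset T} :=
  [set A | H A /\ forall B, H B -> A `<=` B -> A = B].

Definition sign_vectors (R : realType) {T : choiceType} (H : set {fset T}) :
    set (T -> R^o) :=
  [set s | (forall i, s i \in [:: -1; 0; 1]) /\
           exists2 A, H A & forall i, (i \in A) = (s i != 0)].
Arguments sign_vectors R {T} H.

(* The sign vectors as elements of X_F; none is lost, by the lemma below. *)
Definition Xsign_vectors {R : realType} {T : choiceType} (F : covering_family T)
    (H : set {fset T}) : set (Xspace R F) :=
  [set x | sign_vectors R H x].
Arguments Xsign_vectors R {T} F H.

Lemma range_Xsign_vectors (R : realType) (T : choiceType) (F : covering_family T)
    (H : set {fset T}) :
  [set (x : T -> R^o) | x in Xsign_vectors R F H] = sign_vectors R H.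
Proof.
apply/seteqP; split=> [_ [x Hx <-]//|s Hs].
suff sX : is_Xvector F s by exists (XSpace sX).
case: Hs => _ [A _ sA]; rewrite /is_Xvector inE; apply: finite_support_Xset.
rewrite (_ : [set _ | _] = [set` A]); first exact: finite_fset.
by apply/seteqP; split=> i /=; rewrite sA.
Qed.

Record graph (T : Type) := Graph {
  adjacent :> rel T ;
  adjacent_sym : symmetric adjacent ;
  adjacent_irr : irreflexive adjacent }.

Definition induced_subgraph {T : choiceType} (G : graph T) (H : {fset T}) : graph H :=
  @Graph H (fun x y => G (val x) (val y))
    (fun x y => adjacent_sym G (val x) (val y))
    (fun x => adjacent_irr G (val x)).

Definition is_clique {T : choiceType} (G : graph T) (A : {fset T}) : bool :=
  [forall x : A, forall y : A, (x != y) ==> G (val x) (val y)].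

Definition cliques {T : choiceType} (G : graph T) : set {fset T} :=
  [set A | is_clique G A].

Definition clique_number {T : finType} (G : graph T) : nat :=
  \max_(A : {fset T} | is_clique G A) #|` A|.

Definition colorable {T : finType} (G : graph T) (k : nat) : bool :=
  [exists c : {ffun T -> 'I_k}, forall x, forall y, G x y ==> (c x != c y)].

Lemma ex_colorable (T : finType) (G : graph T) : exists k, colorable G k.
Proof.
exists #|T|; apply/existsP; exists [ffun x => enum_rank x].
apply/forallP => x; apply/forallP => y; apply/implyP => xy; rewrite !ffunE.
by apply: contraTneq xy => /enum_rank_inj ->; rewrite adjacent_irr.
Qed.

Definition chromatic_number {T : finType} (G : graph T) : nat :=
  ex_minn (ex_colorable G).

Definition perfect {T : choiceType} (G : graph T) : Prop :=
  forall H : {fset T},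
    chromatic_number (induced_subgraph G H) = clique_number (induced_subgraph G H).

(* Main.v *)
Require Import Defs.
From HB Require Import structures.
From mathcomp Require Import all_boot all_order all_algebra finmap.
From mathcomp Require Import all_classical all_reals all_analysis.
From mathcomp Require Import lra.

Set Implicit Arguments.
Unset Strict Implicit.
Unset Printing Implicit Defensive.

Import Order.TTheory GRing.Theory Num.Theory.
Import numFieldNormedType.Exports.

Local Open Scope classical_set_scope.
Local Open Scope ring_scope.

(** Every condition is equivalent to a Hoelder inequality between the norms of F
    and of its orthogonal family: for finitely supported x and c,
      sum |c i * x i| <= ||c||_(F^perp) * ||x||_F.
    - The unit ball of X_F always contains the hull of the sign vectors supported
      by F^perp, and the inequality says that a linear form has the same supremum
      on both. Separating a point from a convex set in finitely many coordinates
      yields (2) and the weak* statement (4). Conversely, in (1) a linear form on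
      the ball of X_(F|V) attains its maximum at an extreme point.
    - The inequality says exactly that pairing with a vector of Y_F is a functional
      on X_(F^perp) of norm ||.||_F, and likewise with the two families exchanged;
      this is (0).
    - If F is the clique family of a perfect graph, Lovasz's replication argument
      covers an integer weight exactly by as many stable sets as its largest
      clique weight; scaling gives the inequality. Conversely, testing the
      inequality on indicators of non-members forces F to be a clique family, and
      testing it on the sum of the indicators of all maximum cliques yields a
      stable set meeting each of them, hence an optimal colouring by induction. *)

(** * Weighted colourings of perfect graphs *)

Lemma is_cliqueP (T : choiceType) (G : graph T) (A : {fset T}) :
  reflect {in A &, forall x y, x != y -> G x y} (is_clique G A).
Proof.
apply: (iffP 'forall_forallP) => [GA x y xA yA xy|GA x y].
  by have /implyP := GA [` xA]%fset [` yA]%fset; apply; rewrite -val_eqE.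
by apply/implyP => xy; apply: GA; rewrite ?fsvalP// val_eqE.
Qed.

Definition stable (T : choiceType) (G : graph T) (S : {fset T}) : Prop :=
  {in S &, forall x y, ~~ G x y}.

Lemma cardfs_le1 (T : choiceType) (A : {fset T}) :
  reflect {in A &, forall x y, x = y} (#|` A| <= 1)%N.
Proof.
apply: (iffP idP) => [A1 x y xA yA|A1].
  apply/eqP; apply: contraTT A1 => xy.
  have : ([fset x; y] `<=` A)%fset by apply/fsubsetP => z /fset2P[]->.
  by move=> /fsubset_leq_card; rewrite cardfs2 xy -ltnNge.
have [->|/fset0Pn[x xA]] := eqVneq A fset0; first by rewrite cardfs0.
rewrite -(cardfs1 x); apply: fsubset_leq_card; apply/fsubsetP => y yA.
by rewrite inE; apply/eqP; exact: A1.
Qed.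

Lemma sum_mem_fset (T : choiceType) (A B : {fset T}) :
  (\sum_(i <- A) (i \in B))%N = #|` (A `&` B)%fset|.
Proof.
rewrite -big_mkcond/= sum1_count -size_filter; apply/eqP.
rewrite eqn_leq; apply/andP; split; apply: uniq_leq_size;
  rewrite ?filter_uniq ?fset_uniq// => i; rewrite mem_filter !inE andbC//.
Qed.

Lemma clique_stable_card (T : choiceType) (G : graph T) (K S : {fset T}) :
  is_clique G K -> stable G S -> (#|` (K `&` S)%fset| <= 1)%N.
Proof.
move=> /is_cliqueP GK GS; apply/cardfs_le1 => x y /fsetIP[xK xS] /fsetIP[yK yS].
by apply/eqP; apply: contraTT (GS x y xS yS) => xy; rewrite negbK GK.
Qed.

Lemma ltn_sum_fset (T : choiceType) (v : T) (V : {fset T}) (w w' : T -> nat) :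
  v \in V -> {in V, forall u, w' u <= w u}%N -> (w' v < w v)%N ->
  (\sum_(u <- V) w' u < \sum_(u <- V) w u)%N.
Proof.
move=> vV ww' wv; rewrite !(big_fsetD1 v vV)/= -addSn leq_add//.
rewrite !big_seq; apply: leq_sum => u; rewrite in_fsetD1 => /andP[_ uV].
exact: ww'.
Qed.

Lemma induced_clique_le (T : choiceType) (G : graph T) (H : {fset T}) (m : nat) :
  (forall K, is_clique G K -> K `<=` H -> #|` K| <= m)%fset%N ->
  (clique_number (induced_subgraph G H) <= m)%N.
Proof.
move=> Hm; apply/bigmax_leqP => A /is_cliqueP GA.
have <- : #|` [fset val x | x in A]%fset| = #|` A|.
  by rewrite card_imfset//; exact: val_inj.
apply: Hm.
  apply/is_cliqueP => _ _ /imfsetP[x /= xA ->] /imfsetP[y /= yA ->] xy.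
  exact: (GA x y xA yA).
by apply/fsubsetP => _ /imfsetP[x /= _ ->]; exact: fsvalP.
Qed.

(** Clique and chromatic numbers live on the subtype of points of [H]; here perfection becomes a
    colouring on all of [T], with the junk colour 0 outside [H]. *)
Lemma perfect_coloring (T : choiceType) (G : graph T) (H : {fset T}) (m : nat) :
  perfect G ->
  (forall K, is_clique G K -> K `<=` H -> #|` K| <= m)%fset%N ->
  exists c : T -> nat, {in H, forall x, c x < m}%N /\
    {in H &, forall x y, G x y -> c x != c y}.
Proof.
move=> /(_ H); rewrite /chromatic_number; case: ex_minnP => k.
move=> /existsP[c /'forall_forallP Gc] _ kE /induced_clique_le; rewrite -kE => km.
pose d x := if insub x is Some z then c z : nat else 0%N.
have dE x (xH : x \in H) : d x = c [` xH]%fset.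
  by rewrite /d insubT.
exists d; split=> [x xH|x y xH yH Gxy]; rewrite !dE.
  exact: leq_trans (ltn_ord _) km.
by rewrite val_eqE; have /implyP := Gc [` xH]%fset [` yH]%fset; exact.
Qed.

Lemma count_sum (S T : Type) (s : seq S) (P : S -> T -> bool) x :
  count (fun A => P A x) s = (\sum_(A <- s) (P A x))%N.
Proof. by rewrite -big_mkcond/= sum1_count. Qed.

(* Lovasz's replication argument: if [w v >= 2], lower [w v] by one, take a
   stable set [S] containing [v] from a cover, and recurse on [w] minus the
   indicator of [S]; every clique loses weight because the other stable sets of
   the cover meet it at most once. *)
Lemma weighted_stable_cover (T : choiceType) (G : graph T) (V : {fset T})
    (m : nat) (w : T -> nat) : perfect G ->
  (forall K, is_clique G K -> K `<=` V -> \sum_(u <- K) w u <= m)%fset%N ->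
  exists s : seq {fset T}, [/\ size s = m,
    forall S, S \in s -> stable G S /\ (S `<=` V)%fset &
    {in V, forall u, w u = count (fun S : {fset T} => u \in S) s}].
Proof.
move=> pG; move: {2}(\sum_(u <- V) w u).+1%N (ltnSn (\sum_(u <- V) w u)) => n.
elim: n => // n IHn in m w *; rewrite ltnS => wn wm.
have [/hasP[v vV wv]|/hasPn w1] := boolP (has (fun v => 1 < w v)%N V); last first.
  (* All weights on [V] are at most 1: [w] is the indicator of [H], and the [m] colour classes of
     [H], some possibly empty, form the cover. *)
  pose H := [fset u in V | w u == 1%N]%fset.
  have wE u : u \in V -> w u = (u \in H) :> nat.
    by move=> uV; rewrite !inE uV/=; move: (w1 u uV); case: (w u) => [|[]].
  have HV : (H `<=` V)%fset by apply/fsubsetP => u; rewrite !inE => /andP[].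
  have [K GK KH|c [cm cG]] := @perfect_coloring _ G H m pG.
    have /fsubsetP KV := fsubset_trans KH HV.
    apply: leq_trans (wm K GK _); last exact/fsubsetP.
    rewrite -sum1_size/= big_seq [leqRHS]big_seq; apply: eq_leq; apply: eq_bigr => u uK.
    by rewrite wE ?KV// (fsubsetP KH).
  exists [seq [fset u in H | c u == k]%fset | k <- iota 0 m].
  rewrite size_map size_iota; split=> // [_ /mapP[k _ ->]|u uV].
    split; last by apply: fsubset_trans HV; apply/fsubsetP => u; rewrite !inE => /andP[].
    move=> x y; rewrite !inE/= -!andbA => /and3P[xV xw /eqP xk] /and3P[yV yw /eqP yk].
    by apply/negP => /cG; rewrite !inE xV xw yV yw xk yk eqxx => /(_ isT isT).
  rewrite wE// count_map; have [uH|uH] := boolP (u \in H).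
    rewrite (@eq_in_count _ _ (pred1 (c u))) ?count_uniq_mem ?iota_uniq ?mem_iota//=.
      by rewrite add0n cm.
    by move: uH; rewrite !inE => /andP[_ wu] k _ /=; rewrite !inE/= uV wu/= eq_sym.
  rewrite (@eq_in_count _ _ pred0) ?count_pred0// => k _ /=.
  by apply: contraNF uH; rewrite !inE => /andP[].
pose w' u := (w u - (u == v))%N.
have ww' u : (w' u <= w u)%N by exact: leq_subr.
have w'v : (w' v < w v)%N.
  by rewrite /w' eqxx subn1; case: (w v) wv => // -[].
have [||s [sm sG sw]] := IHn m w'.
- exact: leq_trans (ltn_sum_fset vV _ w'v) wn.
- move=> K GK KV; apply: leq_trans (wm K GK KV); exact: leq_sum.
have : has (fun S : {fset T} => v \in S) s.
  by rewrite has_count -sw// /w' eqxx subn_gt0.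
case/hasP=> S Ss vS; have [GS SV] := sG S Ss.
have m0 : (0 < m)%N by rewrite -sm; case: (s) Ss.
(* [S] is subtracted from the original weight [w], not from [w']; only at [v] can the result exceed
   what the other sets in the cover of [w'] provide. *)
pose w2 u := (w u - (u \in S))%N.
have Sw u : u \in V -> ((u \in S) <= w u)%N.
  move=> uV; case: (boolP (u \in S)) => //= uS; apply: leq_trans (ww' u).
  by rewrite sw// -has_count; apply/hasP; exists S.
have w2v : (w2 v < w v)%N by rewrite /w2 vS subn1; case: (w v) wv => // -[].
have w2E u : u \in V -> (w2 u <= count (fun A : {fset T} => u \in A) (rem S s) + (u == v))%N.
  move=> uV; rewrite /w2 leq_subLR.
  have : (w u <= w' u + (u == v))%N by rewrite addnC -leq_subLR.
  move/leq_trans; apply; rewrite addnA leq_add2r sw//.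
  by have /permP -> := perm_to_rem Ss.
have [||t [tm tG tw]] := IHn m.-1 w2.
- apply: leq_trans (ltn_sum_fset vV _ w2v) wn => u _; exact: leq_subr.
(* A clique through [v] loses weight at [v], which lies in [S]; any other clique is met at most once
   by each of the [m.-1] remaining sets. *)
- move=> K GK KV; rewrite -ltnS prednK//; have [vK|vK] := boolP (v \in K).
    apply: leq_trans (wm K GK KV); apply: (@ltn_sum_fset _ v) => // u _.
    exact: leq_subr.
  rewrite -sm (perm_size (perm_to_rem Ss))/= ltnS.
  apply: (@leq_trans (\sum_(u <- K) \sum_(A <- rem S s) (u \in A)))%N.
    rewrite big_seq [leqRHS]big_seq; apply: leq_sum => u uK.
    have := w2E u (fsubsetP KV u uK); rewrite count_sum.
    by have [uv|_] := eqVneq u v; [rewrite -uv uK in vK|rewrite addn0].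
  rewrite exchange_big/= -sum1_size big_seq [leqRHS]big_seq.
  apply: leq_sum => A /mem_rem As; rewrite sum_mem_fset.
  by apply: clique_stable_card GK _; have [] := sG A As.
exists (S :: t); split=> [|A|u uV] /=; first by rewrite tm prednK.
  by rewrite inE => /orP[/eqP->//|]; exact: tG.
by rewrite -tw// /w2 subnKC// Sw.
Qed.

(** * The pairing inequality and perfection *)

(* [a] and [b] stand for the norms of [x] and [c], both read as supported on
   [V]: hence only the members inside [V] matter. *)
Definition pairing_bound (R : realType) (T : choiceType) (F : covering_family T) : Prop :=
  forall (V : {fset T}) (x c : T -> R) (a b : R),
    (forall A, F A -> A `<=` V -> \sum_(i <- A) `|x i| <= a)%fset ->
    (forall E, perp F E -> E `<=` V -> \sum_(i <- E) `|c i| <= b)%fset ->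
    \sum_(i <- V) `|c i * x i| <= b * a.

Lemma members0 (T : choiceType) (F : covering_family T) : F fset0.
Proof.
have [i _] := carrier_neq0 F; have [A FA _] := members_cover F i.
exact: members_hereditary (fsub0set A) FA.
Qed.

Lemma members1 (T : choiceType) (F : covering_family T) i : F [fset i]%fset.
Proof.
have [A FA iA] := members_cover F i.
by apply: members_hereditary FA; rewrite fsub1set.
Qed.

(** A positive gap [p - q] multiplied by a large [n] would exceed the fixed error [r]; this absorbs
    rounding errors. *)
Lemma le_archi (R : realType) (p q r : R) :
  (forall n : nat, n%:R * p <= n%:R * q + r) -> p <= q.
Proof.
move=> H; rewrite leNgt; apply/negP => qp.
have d0 : 0 < p - q by rewrite subr_gt0.
have := H (Num.truncn (r / (p - q))).+1.
rewrite -lerBlDl -mulrBr leNgt => /negP; apply.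
rewrite -ltr_pdivrMr//; exact: truncnS_gt.
Qed.

Lemma sum_fset_indic (R : pzRingType) (T : choiceType) (S V : {fset T}) (f : T -> R) :
  (S `<=` V)%fset -> \sum_(u <- V) f u * (u \in S)%:R = \sum_(u <- S) f u.
Proof.
move=> SV; rewrite -(big_fset_incl _ SV) => [|u _ /negPf->]; last by rewrite mulr0.
by rewrite !big_seq; apply: eq_bigr => u ->; rewrite mulr1.
Qed.

(** An edge is a two-point clique, so an orthogonal set contains none; conversely a clique meets a
    stable set at most once. *)
Lemma stable_perp (T : choiceType) (F : covering_family T) (G : graph T) (S : {fset T}) :
  members F = cliques G -> perp F S <-> stable G S.
Proof.
move=> FG; split=> [FS x y xS yS|GS A].
  apply/negP => Gxy; have xy : x != y.
    by apply: contraTneq Gxy => ->; rewrite adjacent_irr.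
  have /FS : F [fset x; y]%fset.
    rewrite FG; apply/is_cliqueP => _ _ /fset2P[]-> /fset2P[]->; rewrite ?eqxx//.
    by rewrite adjacent_sym.
  move=> /cardfs_le1/(_ x y); rewrite !inE xS yS !eqxx orbT => /(_ isT isT) xyE.
  by rewrite xyE eqxx in xy.
by rewrite FG fsetIC => GA; exact: clique_stable_card GA GS.
Qed.

(** The weight [n * |x|], rounded down, is covered by at most [n * a] stable sets, each carrying at
    most [b] of [|c|]. The rounding error, at most the sum of [|c|], does not grow with [n]. *)
Lemma perfect_pairing_bound (R : realType) (T : choiceType) (F : covering_family T)
    (G : graph T) :
  perfect G -> members F = cliques G -> pairing_bound R F.
Proof.
move=> pG FG V x c a b xa cb.
have a0 : 0 <= a.
  by have := xa _ (members0 F) (fsub0set _); rewrite big_seq_fset0.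
have b0 : 0 <= b.
  by have := cb _ (members0 (perp F)) (fsub0set _); rewrite big_seq_fset0.
apply: (@le_archi _ _ _ (\sum_(i <- V) `|c i|)) => n.
pose w i := Num.truncn (n%:R * `|x i|).
have wx i : (w i)%:R <= n%:R * `|x i| by rewrite truncn_le mulr_ge0.
have xw i : n%:R * `|x i| <= (w i)%:R + 1.
  by rewrite natr1; apply/ltW; exact: truncnS_gt.
have na0 : 0 <= n%:R * a by rewrite mulr_ge0.
have [K GK KV|s [sm sG sw]] := @weighted_stable_cover _ G V (Num.truncn (n%:R * a)) w pG.
  rewrite truncn_ge_nat// natr_sum; apply: le_trans (ler_sum _ (fun i _ => wx i)) _.
  by rewrite -mulr_sumr ler_wpM2l// xa// FG.
have cw : \sum_(i <- V) `|c i| * (w i)%:R <= n%:R * (b * a).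
  rewrite [leRHS](_ : _ = n%:R * a * b); last by rewrite mulrAC mulrA.
  apply: (@le_trans _ _ ((size s)%:R * b)); last first.
    by rewrite ler_wpM2r// sm truncn_le.
  rewrite (_ : \sum_(i <- V) _ = \sum_(S <- s) \sum_(i <- S) `|c i|).
    rewrite -sum1_size natr_sum mulr_suml big_seq [leRHS]big_seq; apply: ler_sum => S Ss.
    have [GS SV] := sG S Ss; rewrite mul1r; apply: cb => //.
    exact/(stable_perp _ FG).
  rewrite [RHS]big_seq (eq_bigr (fun S : {fset T} => \sum_(i <- V) `|c i| * (i \in S)%:R)).
    rewrite -big_seq exchange_big/= !big_seq; apply: eq_bigr => i iV.
    by rewrite sw// count_sum natr_sum mulr_sumr.
  by move=> S Ss; rewrite sum_fset_indic//; have [] := sG S Ss.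
apply: le_trans (_ : \sum_(i <- V) `|c i| * ((w i)%:R + 1) <= _).
  rewrite mulr_sumr; apply: ler_sum => i _.
  by rewrite normrM mulrCA ler_wpM2l.
under eq_bigr do rewrite mulrDr mulr1.
by rewrite big_split lerD.
Qed.

(** * The graph of two-point members and its perfection *)

Section PerfectionFromPairing.
Context (R : realType) (T : choiceType) (F : covering_family T).
Hypothesis PF : pairing_bound R F.

(** If [F] is the clique family of any graph, the edges can only be the two-point members. *)
Definition pair_adjacency : rel T := fun x y => (x != y) && `[< F [fset x; y]%fset >].

Lemma pair_adjacency_sym : symmetric pair_adjacency.
Proof. by move=> x y; rewrite /pair_adjacency eq_sym fsetUC. Qed.

Lemma pair_adjacency_irr : irreflexive pair_adjacency.
Proof. by move=> x; rewrite /pair_adjacency eqxx. Qed.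

Definition pair_graph := Graph pair_adjacency_sym pair_adjacency_irr.

Lemma perp_clique (K E : {fset T}) :
  is_clique pair_graph K -> perp F E -> (E `<=` K)%fset -> (#|` E| <= 1)%N.
Proof.
move=> /is_cliqueP GK FE /fsubsetP EK; apply/cardfs_le1 => x y xE yE.
apply/eqP; apply: contraT => xy.
have /andP[_ /asboolP/FE/cardfs_le1/(_ x y)] := GK x y (EK _ xE) (EK _ yE) xy.
by rewrite !inE xE yE !eqxx orbT => /(_ isT isT) xyE; rewrite xyE eqxx in xy.
Qed.

Lemma sum_norm1 (A : {fset T}) : \sum_(i <- A) `|1 : R| = #|` A|%:R.
Proof. by rewrite normr1 -sum1_size natr_sum. Qed.

(** On a clique [K] outside [F] the constant 1 is paired with itself: members inside [K] are proper
    subsets, so [a] may be one less than the size of [K], and orthogonal sets inside [K] have at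
    most one point, so [b] may be 1. The inequality then fails. *)
Lemma pairing_bound_cliques : members F = cliques pair_graph.
Proof.
apply/seteqP; split=> K /=.
  move=> FK; apply/is_cliqueP => x y xK yK xy; rewrite /= /pair_adjacency xy/=.
  apply/asboolP; apply: members_hereditary FK.
  by apply/fsubsetP => z /fset2P[]->.
move=> GK; have [->|K0] := eqVneq K fset0; first exact: members0.
apply: contrapT => FK;
  have := PF (V := K) (x := fun=> 1) (c := fun=> 1) (a := (#|` K|.-1)%:R) (b := 1).
rewrite mulr1 mul1r sum_norm1 => /(_ _ _)/wrap[A FA AK|E FE EK|].
- rewrite sum_norm1 ler_nat -ltnS prednK ?cardfs_gt0//; apply: fproper_ltn_card.
  rewrite fproperEneq AK andbT; by apply: contra_notN FK => /eqP<-.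
- rewrite sum_norm1 -[leRHS]/(1%:R) ler_nat; exact: perp_clique GK FE EK.
by rewrite ler_nat leqNgt prednK ?cardfs_gt0// leqnn.
Qed.

(* Otherwise weight each vertex by the number of [n]-cliques through it: these
   weights sum to [n] times the number of [n]-cliques, whereas every member of
   the orthogonal family carries strictly less than the number of cliques. *)
Lemma stable_transversal (H : {fset T}) (n : nat) :
  (forall K, is_clique pair_graph K -> K `<=` H -> #|` K| <= n.+1)%fset%N ->
  exists S : {fset T}, [/\ stable pair_graph S, (S `<=` H)%fset &
    forall K, is_clique pair_graph K -> (K `<=` H)%fset -> #|` K| = n.+1 ->
      (K `&` S)%fset != fset0].
Proof.
move=> Hn; apply: contrapT => /forallNP noS.
pose KK := [fset K in fpowerset H | is_clique pair_graph K && (#|` K| == n.+1)]%fset.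
have inKK K : (K \in KK) = [&& (K `<=` H)%fset, is_clique pair_graph K & #|` K| == n.+1].
  by rewrite !inE fpowersetE.
have miss S : stable pair_graph S -> (S `<=` H)%fset ->
    exists2 K, K \in KK & (K `&` S)%fset = fset0.
  move=> GS SH; apply: contrapT => KS; apply: (noS S); split=> // K GK KH Kn.
  by apply/eqP => KS0; apply: KS; exists K => //; rewrite inKK KH GK Kn eqxx.
pose c i : R := (\sum_(K <- KK) (i \in K))%N%:R.
have sumc (S : {fset T}) : \sum_(i <- S) `|c i| = (\sum_(K <- KK) #|` (S `&` K)%fset|)%N%:R.
  transitivity (\sum_(i <- S) c i); first by apply: eq_bigr => i _; rewrite normr_nat.
  rewrite -natr_sum exchange_big/=; congr _%:R; apply: eq_bigr => K _.
  by rewrite sum_mem_fset.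
(* The empty set is stable and so misses some clique; hence [KK] is not empty and its size has a
   proper predecessor. *)
have KK0 : (0 < #|` KK|)%N.
  have [//||K KKK _] := miss fset0; first exact: fsub0set.
  by rewrite cardfs_gt0; apply/fset0Pn; exists K.
have := PF (V := H) (x := fun=> 1) (c := c) (a := n.+1%:R) (b := (#|` KK|.-1)%:R).
under eq_bigr do rewrite mulr1.
rewrite sumc => /(_ _ _)/wrap[A FA AH|E FE EH|].
- rewrite sum_norm1 ler_nat; apply: Hn => //; by move: FA; rewrite pairing_bound_cliques.
- have GE := (stable_perp _ pairing_bound_cliques).1 FE.
  rewrite sumc ler_nat -ltnS prednK//; have [K KKK KE] := miss E GE EH.
  (* The clique [K] missed by [E] contributes nothing, every other one at most 1. *)
  rewrite (big_fsetD1 K KKK)/= fsetIC KE cardfs0 add0n (cardfsD1 K KK) KKK ltnS.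
  rewrite -sum1_size big_seq [leqRHS]big_seq; apply: leq_sum => K'.
  rewrite in_fsetD1 inKK => /and4P[_ _ GK' _]; rewrite fsetIC.
  exact: clique_stable_card GK' GE.
rewrite -natrM ler_nat leqNgt => /negP; apply.
have -> : (\sum_(K <- KK) #|` (H `&` K)%fset| = #|` KK| * n.+1)%N.
  rewrite -sum1_size big_distrl/= !big_seq; apply: eq_bigr => K.
  by rewrite inKK mul1n => /and3P[/fsetIidPr-> _ /eqP].
by rewrite ltn_pmul2r ?prednK.
Qed.

(** Removing a stable set that meets all cliques of the largest allowed size lowers the bound by
    one; this set receives the new colour [n]. *)
Lemma clique_bound_coloring (n : nat) (H : {fset T}) :
  (forall K, is_clique pair_graph K -> K `<=` H -> #|` K| <= n)%fset%N ->
  exists c : T -> nat, {in H, forall x, c x < n}%N /\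
    {in H &, forall x y, pair_graph x y -> c x != c y}.
Proof.
elim: n H => [|n IHn] H Hn.
  (* Singletons are cliques, so the bound 0 forces [H] to be empty. *)
  exists (fun=> 0%N); split=> [x xH|x y xH].
    have : is_clique pair_graph [fset x]%fset.
      by apply/is_cliqueP => y z /fset1P-> /fset1P->; rewrite eqxx.
    by move=> /Hn; rewrite fsub1set cardfs1 => /(_ xH).
  have : is_clique pair_graph [fset x]%fset.
    by apply/is_cliqueP => ? ? /fset1P-> /fset1P->; rewrite eqxx.
  by move=> /Hn; rewrite fsub1set cardfs1 => /(_ xH).
have [S [GS SH SK]] := stable_transversal Hn.
have [K GK KHS|c [cn cG]] := IHn (H `\` S)%fset.
  have KH := fsubset_trans KHS (fsubsetDl _ _).
  have := Hn K GK KH; rewrite leq_eqVlt => /orP[/eqP/(SK K GK KH)/fset0Pn[x]|//].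
  by rewrite inE => /andP[/(fsubsetP KHS)]; rewrite inE => /andP[/negPf->].
exists (fun x => if x \in S then n else c x); split=> [x xH|x y xH yH Gxy].
  by case: ifPn => // xS; apply: leqW; apply: cn; rewrite inE xS.
have cS z : z \in H -> z \notin S -> c z != n.
  by move=> zH zS; rewrite ltn_eqF// cn// inE zS.
have [xS|xS] := ifPn; have [yS|yS] := ifPn.
- by have := GS x y xS yS; rewrite Gxy.
- by rewrite eq_sym cS.
- by rewrite cS.
- by apply: cG => //; rewrite inE ?xS ?yS.
Qed.

Lemma pairing_bound_perfect : perfect pair_graph.
Proof.
move=> H; apply/eqP; rewrite eqn_leq; apply/andP; split.
  rewrite /chromatic_number; case: ex_minnP => k _; apply.
  have [K GK KH|c [cn cG]] := @clique_bound_coloring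
      (clique_number (induced_subgraph pair_graph H)) H.
    pose K' := [fset x : H | val x \in K]%fset.
    have -> : #|` K| = #|` K'|.
      have <- : [fset val x | x in K']%fset = K.
        apply/fsetP => x; apply/imfsetP/idP => [[y /=]|xK].
          by rewrite !inE => yK ->.
        by exists [` fsubsetP KH x xK]%fset; rewrite ?inE.
      by rewrite card_imfset//; exact: val_inj.
    apply: (@leq_bigmax_cond _ _ _ K'); apply/is_cliqueP => x y.
    by rewrite !inE -val_eqE => xK yK xy; exact: (is_cliqueP _ _ GK).
  apply/existsP; exists [ffun x : H => Ordinal (cn (val x) (fsvalP x))].
  apply/'forall_forallP => x y; apply/implyP => /= Gxy.
  by rewrite !ffunE -val_eqE/= cG ?fsvalP.
rewrite /chromatic_number; case: ex_minnP => k /existsP[c /'forall_forallP Gc] _.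
apply/bigmax_leqP => A /is_cliqueP GA.
have <- : #|` [fset c x | x in A]%fset| = #|` A|.
  rewrite card_in_imfset// => x y xA yA cxy; apply/eqP; apply: contraT => xy.
  by have /implyP/(_ (GA x y xA yA xy)) := Gc x y; rewrite cxy eqxx.
rewrite -[leqRHS](size_enum_ord k) uniq_leq_size ?fset_uniq// => i _.
by rewrite mem_enum.
Qed.

End PerfectionFromPairing.

(** * Convex hulls and separation *)

Section ConvexHull.
Context {R : realType}.
Implicit Types E : lmodType R.

Lemma convex_setE E (A : set E) : @convex_set R E A <->
  forall x y (t : R), A x -> A y -> 0 <= t <= 1 -> A (t *: x + (1 - t) *: y).
Proof.
split=> [cA x y t Ax Ay /andP[t0 t1]|cA x y l /set_mem Ax /set_mem Ay].
  by have /set_mem := cA x y (Itv01 t0 t1) (mem_set Ax) (mem_set Ay).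
by apply/mem_set; apply: cA => //; rewrite ge0 le1.
Qed.

Lemma conv_hull_convex E (A : set E) x y (t : R) :
  conv_hull A x -> conv_hull A y -> 0 <= t <= 1 -> conv_hull A (t *: x + (1 - t) *: y).
Proof.
move=> Ax Ay t01 B [cB AB]; apply: (convex_setE B).1 => //; [exact: Ax|exact: Ay].
Qed.

Lemma sub_conv_hull E (A : set E) : A `<=` conv_hull A.
Proof. exact: sub_gen_smallest. Qed.

Lemma conv_hull_ind E (A B : set E) :
  (forall x y (t : R), B x -> B y -> 0 <= t <= 1 -> B (t *: x + (1 - t) *: y)) ->
  A `<=` B -> conv_hull A `<=` B.
Proof. by move=> cB; apply: smallest_sub; apply/convex_setE. Qed.

Lemma image_conv_hull E E' (f : E -> E') (A : set E) :
  (forall x y (t : R), f (t *: x + (1 - t) *: y) = t *: f x + (1 - t) *: f y) ->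
  f @` conv_hull A = conv_hull (f @` A).
Proof.
move=> lf; apply/seteqP; split=> [_ [x Ax <-]|].
  apply: (conv_hull_ind (B := [set z | conv_hull (f @` A) (f z)])) Ax => /=.
    by move=> y z t Ay Az t01; rewrite lf; exact: conv_hull_convex.
  by move=> z Az; apply: sub_conv_hull; exists z.
apply: conv_hull_ind => [_ _ t [x Ax <-] [y Ay <-] t01|_ [x Ax <-]].
  by rewrite -lf; exists (t *: x + (1 - t) *: y) => //; exact: conv_hull_convex.
by exists x => //; exact: sub_conv_hull.
Qed.

(** Deleting from the hull an extreme point outside [A] would leave a smaller convex set containing
    [A]. *)
Lemma extreme_points_conv_hull E (A : set E) : extreme_points (conv_hull A) `<=` A.
Proof.
move=> x [Ax xext]; apply: contrapT => nAx.
suff /(_ x Ax)[_] : conv_hull A `<=` [set z | conv_hull A z /\ z <> x] by [].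
apply: conv_hull_ind => [y z t [Ay yx] [Az zx] /andP[]|z Az]; last first.
  by split; [exact: sub_conv_hull|move=> zx; rewrite zx in Az].
rewrite le_eqVlt => /predU1P[<- _|t0]; first by rewrite scale0r add0r subr0 scale1r.
rewrite le_eqVlt => /predU1P[->|t1]; first by rewrite scale1r subrr scale0r addr0.
split; first by apply: conv_hull_convex; rewrite ?ltW.
move=> xE; have t01 : 0 < t < 1 by rewrite t0.
have yz := xext y z t Ay Az t01 (esym xE).
by apply: zx; rewrite -xE yz -scalerDl addrC subrK scale1r.
Qed.

(** Leaving the weights unnormalised lets the induction pass to the tail of the list. *)
Lemma conv_hull_sum E (A : set E) (J : Type) (r : seq J) (l : J -> R) (s : J -> E) :
  (forall j, 0 <= l j) -> (forall j, A (s j)) -> 0 < \sum_(j <- r) l j ->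
  conv_hull A ((\sum_(j <- r) l j)^-1 *: \sum_(j <- r) l j *: s j).
Proof.
move=> l0 As; elim: r => [|j r IHr]; first by rewrite big_nil ltxx.
rewrite !big_cons; set L := \sum_(j <- r) l j; rewrite -/L in IHr.
have : 0 <= L by exact: sumr_ge0.
rewrite le_eqVlt => /predU1P[L0|L0] lL.
  (* A tail of total weight 0 cannot be normalised, but all its terms vanish. *)
  rewrite -L0 addr0 in lL *.
  have -> : \sum_(j <- r) l j *: s j = 0.
    have l00 : forall j', l j' = 0 -> l j' *: s j' = 0 by move=> ? ->; rewrite scale0r.
    move: L0; rewrite /L; elim: (r) => [|j' r' IHr']; first by rewrite !big_nil.
    rewrite !big_cons => /esym/eqP;
      rewrite paddr_eq0 ?sumr_ge0// => /andP[/eqP/l00-> /eqP r'0].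
    by rewrite add0r IHr'.
  rewrite addr0 scalerA mulVf ?gt_eqF// scale1r; exact: sub_conv_hull.
have -> : (l j + L)^-1 *: (l j *: s j + \sum_(j <- r) l j *: s j) =
    (l j / (l j + L)) *: s j + (1 - l j / (l j + L)) *: (L^-1 *: \sum_(j <- r) l j *: s j).
  rewrite scalerDr !scalerA; congr (_ *: _ + _ *: _); first by rewrite mulrC.
  by rewrite -[X in X - _](mulfV (lt0r_neq0 lL)) -mulrBl
    addrAC subrr add0r mulrAC mulfV ?mul1r// gt_eqF.
apply: conv_hull_convex; [exact: sub_conv_hull|exact: IHr|].
by rewrite divr_ge0 ?(ltW lL)//= ler_pdivrMr// mul1r lerDl ltW.
Qed.

End ConvexHull.

(** * Separation in finitely many coordinates *)

Section Separation.
Context {R : realType} {I : finType}.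
Implicit Types (x y z c p : I -> R^o).

(* [y] almost realises the squared distance [m] from [p] to [C]; then
   [c = p - y] separates: moving from [y] towards [z] by a small [t] cannot
   decrease the distance by much, which bounds the inner product of [c] and
   [z - y] by [m / 2], whereas the one of [c] and [p - y] is at least [m]. *)
Lemma convex_approx (C : set (I -> R^o)) p (M : R) :
  (forall x y (t : R), C x -> C y -> 0 <= t <= 1 -> C (t *: x + (1 - t) *: y)) ->
  C !=set0 -> (forall x y, C x -> C y -> \sum_i (x i - y i) ^+ 2 <= M) ->
  (forall c (d : R), (forall x, C x -> \sum_i c i * x i <= d) -> \sum_i c i * p i <= d) ->
  forall e : R, 0 < e -> exists2 x, C x & \sum_i (p i - x i) ^+ 2 < e.
Proof.
move=> cC C0 CM Cp e e0; apply: contrapT => Ce.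
pose D := [set \sum_i (p i - x i) ^+ 2 | x in C].
have {}Ce x : C x -> e <= \sum_i (p i - x i) ^+ 2.
  by move=> Cx; rewrite leNgt; apply/negP => xe; apply: Ce; exists x.
have infD : has_inf D.
  split; first by have [x Cx] := C0; exists (\sum_i (p i - x i) ^+ 2), x.
  by exists e => _ [x Cx <-]; exact: Ce.
pose m := inf D.
have m0 : 0 < m.
  by apply: lt_le_trans e0 _; apply: lb_le_inf infD.1 _ => _ [x Cx <-]; exact: Ce.
have mC x : C x -> m <= \sum_i (p i - x i) ^+ 2.
  by move=> Cx; apply: (ge_inf infD.2); exists x.
have M0 : 0 <= M.
  have [x Cx] := C0; apply: le_trans (CM x x Cx Cx).
  by apply: sumr_ge0 => i _; exact: sqr_ge0.
(* With this [t] the quadratic term and the defect [t ^+ 2] of [y], together at most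
   [t ^+ 2 * (M + 1)], do not exceed [t * m]. *)
pose t := Num.min 1 (m / (M + 1)).
have t0 : 0 < t by rewrite lt_min ltr01 divr_gt0// ltr_wpDl.
have t1 : t <= 1 by rewrite ge_min lexx.
have tM : t * (M + 1) <= m by rewrite -ler_pdivlMr ?ltr_wpDl// ge_min lexx orbT.
have [_ [y Cy <-] ym] : exists2 d, D d & d < inf D + t ^+ 2.
  by apply: inf_adherent => //; exact: exprn_gt0.
rewrite -/m in ym.
pose c : I -> R^o := fun i => p i - y i.
have cz z : C z -> \sum_i c i * z i <= \sum_i c i * y i + m / 2.
  move=> Cz; have t01 : 0 <= t <= 1 by rewrite ltW.
  have := mC _ (cC z y t Cz Cy t01).
  rewrite (_ : \sum_i _ = \sum_i (c i) ^+ 2 - t *+ 2 * (\sum_i c i * z i - \sum_i c i * y i)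
     + t ^+ 2 * \sum_i (z i - y i) ^+ 2); last first.
    rewrite -sumrB !mulr_sumr -sumrB -big_split/=; apply: eq_bigr => i _.
    by rewrite !fctE /c /GRing.scale/=; lra.
  have := CM z y Cz Cy; have : \sum_i c i ^+ 2 < m + t ^+ 2 by [].
  set q := \sum_i (z i - y i) ^+ 2; set u := \sum_i c i * z i - _.
  set v := \sum_i c i ^+ 2 => vm qM mvu.
  have : t * (u *+ 2) <= t * (t * (M + 1)) by nra.
  rewrite ler_pM2l// -lerBlDl -/u; lra.
have := Cp c _ cz; have := mC y Cy.
have -> : \sum_i (p i - y i) ^+ 2 = \sum_i c i * p i - \sum_i c i * y i.
  by rewrite -sumrB; apply: eq_bigr => i _; rewrite /c; lra.
lra.
Qed.

End Separation.

(** * Compactness in finite dimension *)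

Section FiniteCompactness.
Context {R : realType} {I : finType}.

(** Rows indexed by an enumeration of [I] carry the finite-dimensional topology in which closed
    bounded sets are compact. *)
Definition fun_of_row (v : 'rV[R]_#|I|) : I -> R^o := fun i => v ord0 (enum_rank i).

Definition row_of_fun (x : I -> R^o) : 'rV[R]_#|I| := \row_j x (enum_val j).

Lemma row_of_funK : cancel row_of_fun fun_of_row.
Proof. by move=> x; apply/funext => i; rewrite /fun_of_row mxE enum_rankK. Qed.

Lemma continuous_fun_of_row i : continuous (fun v => fun_of_row v i : R).
Proof. exact: coord_continuous. Qed.

Lemma continuous_sum_row (T : topologicalType) (J : Type) (r : seq J) (P : pred J)
    (f : J -> T -> R) :
  (forall j, P j -> continuous (f j)) ->
  continuous (fun v => \sum_(j <- r | P j) f j v).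
Proof.
move=> fc v; apply: cvg_big => [|j Pj]; last exact: fc.
exact: add_continuous.
Qed.

Lemma compact_fun_max (K : set (I -> R^o)) (f : 'rV[R]_#|I| -> R) (M : R) :
  K !=set0 -> (forall x i, K x -> `|x i| <= M) ->
  closed (fun_of_row @^-1` K) -> continuous f ->
  exists2 x, K x & forall y, K y -> f (row_of_fun y) <= f (row_of_fun x).
Proof.
move=> [x0 Kx0] KM Kc fc.
have Krow x : K x -> (fun_of_row @^-1` K) (row_of_fun x).
  by rewrite /= row_of_funK.
have rowK v : row_of_fun (fun_of_row v) = v.
  by apply/rowP => j; rewrite mxE /fun_of_row enum_valK.
have Kb : bounded_set (fun_of_row @^-1` K).
  exists (Num.max 0 M); split; first exact: num_real.
  move=> M' /ltW; rewrite ge_max => /andP[M'0 MM'] v Kv.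
  rewrite /= [X in X <= _]mx_normrE; apply: bigmax_le => // -[i j] _ /=.
  apply: le_trans MM'; rewrite -[v]rowK mxE.
  exact: KM _ _ Kv.
have Kcomp := bounded_closed_compact Kb Kc.
have [||v Kv vmax] := @EVT_max_rV R _ f _ _ Kcomp.
- by exists (row_of_fun x0); exact: Krow.
- exact: continuous_subspaceT.
exists (fun_of_row v); first by move/set_mem: Kv.
by move=> y Ky; rewrite rowK; apply: vmax; apply/mem_set; exact: Krow.
Qed.

(* A point of largest Euclidean norm among the maximisers of a linear form is
   extreme, since the squared norm is strictly convex. *)
Lemma extreme_maximizer (K : set (I -> R^o)) (c : I -> R) (M : R) :
  K !=set0 -> (forall x i, K x -> `|x i| <= M) ->
  closed (fun_of_row @^-1` K) ->
  exists2 x, extreme_points K x & forall y, K y -> \sum_i c i * y i <= \sum_i c i * x i.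
Proof.
move=> K0 KM Kc.
have lincont : continuous (fun v => \sum_i c i * fun_of_row v i : R).
  apply: continuous_sum_row => i _ v.
  exact: (@cvgM _ _ (nbhs v) _ (fun=> c i) (fun v => fun_of_row v i) _ _
    (cvg_cst _) (@continuous_fun_of_row i v)).
have [x0 Kx0 x0max'] := compact_fun_max K0 KM Kc lincont.
have {x0max'}x0max y : K y -> \sum_i c i * y i <= \sum_i c i * x0 i.
  by move=> /x0max'; rewrite !row_of_funK.
pose K1 := K `&` [set x | \sum_i c i * x i = \sum_i c i * x0 i].
have K10 : K1 !=set0 by exists x0.
have K1M x i : K1 x -> `|x i| <= M by move=> [Kx _]; exact: KM.
have K1c : closed (fun_of_row @^-1` K1).
  rewrite preimage_setI; apply: closedI => //.
  by apply: (preimage_closed _ (@closed_eq _ _)) => v _; exact: lincont.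
have [|x [Kx xm] xmax'] := compact_fun_max K10 K1M K1c
  (f := fun v => \sum_i fun_of_row v i ^+ 2).
  apply: continuous_sum_row => i _ v.
  exact: continuous_comp (@continuous_fun_of_row i v) (@exprn_continuous _ 2 _).
have {xmax'}xmax y : K1 y -> \sum_i y i ^+ 2 <= \sum_i x i ^+ 2.
  by move=> /xmax'; rewrite !row_of_funK.
exists x; last by move=> y /x0max; rewrite xm.
split=> // y z t Ky Kz /andP[t0 t1] xE.
have := x0max y Ky; have := x0max z Kz; rewrite -xm => zx yx.
(* [x] is a proper convex combination of [y] and [z], so the form is maximal at both and they lie in
   [K1]. *)
have cE : \sum_i c i * x i = t * \sum_i c i * y i + (1 - t) * \sum_i c i * z i.
  rewrite !mulr_sumr -big_split/=; apply: eq_bigr => i _.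
  by rewrite xE !fctE /GRing.scale/=; lra.
have yE : \sum_i c i * y i = \sum_i c i * x i by apply/eqP; rewrite eq_le yx/=; nra.
have zE : \sum_i c i * z i = \sum_i c i * x i by apply/eqP; rewrite eq_le zx/=; nra.
have y2 := xmax y (conj Ky (etrans yE xm)); have z2 := xmax z (conj Kz (etrans zE xm)).
(* Strict convexity in quantitative form: the last term must vanish because neither [y] nor [z] is
   longer than [x]. *)
have x2E : \sum_i x i ^+ 2 = t * \sum_i y i ^+ 2 + (1 - t) * \sum_i z i ^+ 2
    - t * (1 - t) * \sum_i (y i - z i) ^+ 2.
  rewrite !mulr_sumr -big_split/= -sumrB; apply: eq_bigr => i _.
  by rewrite xE !fctE /GRing.scale/=; lra.
have tt : 0 < t * (1 - t) by rewrite mulr_gt0// subr_gt0.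
have : \sum_i (y i - z i) ^+ 2 <= 0 by rewrite -(ler_pM2l tt) mulr0; nra.
move=> le0; apply/funext => i; apply/eqP; rewrite -subr_eq0 -sqrf_eq0 -[_ == 0]negbK.
apply/negP => ne0; move: le0; apply/negP; rewrite -ltNge (bigD1 i)//=.
by rewrite ltr_pwDl// ?lt0r ?ne0 ?sqr_ge0// sumr_ge0// => j _; exact: sqr_ge0.
Qed.

End FiniteCompactness.

(** A point that no linear form separates from finitely many points is a limit of their convex
    combinations; compactness of the simplex of weights turns the limit into an equality. *)
Lemma finite_combination {R : realType} {I J : finType} (s : J -> I -> R) (x : I -> R) :
  J -> (forall c : I -> R, exists j, \sum_i c i * x i <= \sum_i c i * s j i) ->
  exists l : J -> R, [/\ forall j, 0 <= l j, \sum_j l j = 1 &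
    forall i, x i = \sum_j l j * s j i].
Proof.
move=> j0 H.
pose K : set (J -> R^o) := [set l | (forall j, 0 <= l j) /\ \sum_j l j = 1].
pose comb (l : J -> R^o) : I -> R^o := fun i => \sum_j l j * s j i.
have KC l l' (t : R) : K l -> K l' -> 0 <= t <= 1 -> K (t *: l + (1 - t) *: l').
  move=> [l0 l1] [l'0 l'1] /andP[t0 t1]; split=> [j|].
    by rewrite !fctE addr_ge0// mulr_ge0// subr_ge0.
  rewrite (eq_bigr (fun j => t * l j + (1 - t) * l' j))//.
  by rewrite big_split/= -!mulr_sumr l1 l'1; lra.
have Kj j : K (fun k => (k == j)%:R).
  split=> [k|]; first exact: ler0n.
  by rewrite (bigD1 j)//= eqxx big1 ?addr0// => k /negPf->.
have Kle1 l j : K l -> `|l j| <= 1.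
  move=> [l0 l1]; rewrite ger0_norm// -l1 (bigD1 j)//= lerDl; exact: sumr_ge0.
pose B := \sum_i \sum_j `|s j i|.
have combB l i : K l -> `|comb l i| <= B.
  move=> Kl; apply: le_trans (ler_norm_sum _ _ _) _.
  rewrite /B (bigD1 i)//= -[leLHS]addr0 lerD ?sumr_ge0// => [|k _]; last exact: sumr_ge0.
  by apply: ler_sum => j _; rewrite normrM ler_piMl// Kle1.
have combD l l' (t : R) : comb (t *: l + (1 - t) *: l') =
  t *: (comb l : I -> R^o) + (1 - t) *: (comb l' : I -> R^o).
  apply/funext => i; rewrite !fctE /comb /GRing.scale/= !mulr_sumr -big_split/=.
  by apply: eq_bigr => j _; lra.
have approx : forall e : R, 0 < e -> exists2 y, [set comb l | l in K] y &
    \sum_i (x i - y i) ^+ 2 < e.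
  apply: (@convex_approx R I _ x (\sum_(i : I) (B + B) ^+ 2)).
  - move=> _ _ t [l Kl <-] [l' Kl' <-] t01.
    by exists (t *: l + (1 - t) *: l'); [exact: KC|exact: combD].
  - by exists (comb (fun j => (j == j0)%:R)), (fun j => (j == j0)%:R).
  - move=> _ _ [l Kl <-] [l' Kl' <-]; apply: ler_sum => i _.
    rewrite -[leLHS]real_normK ?num_real// lerXn2r ?nnegrE//.
      by rewrite addr_ge0// (le_trans _ (combB l i Kl)).
    by apply: le_trans (ler_normB _ _) _; apply: lerD; exact: combB.
  - move=> c d cd; have [j cj] := H c; apply: le_trans cj _.
    have := cd _ (ex_intro2 _ _ _ (Kj j) erefl).
    rewrite (eq_bigr (fun i => c i * s j i))// => i _.
    by rewrite /comb (bigD1 j)//= eqxx mul1r big1 ?addr0// => k /negPf->; rewrite mul0r.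
have ccomb i : continuous (fun v : 'rV[R]_#|J| => comb (fun_of_row v) i).
  apply: continuous_sum_row => j _ v.
  exact: (@cvgM _ _ (nbhs v) _ (fun v => fun_of_row v j) (fun=> s j i) _ _
    (@continuous_fun_of_row R _ j v) (cvg_cst _)).
have cont : continuous (fun v : 'rV[R]_#|J| => - \sum_i (x i - comb (fun_of_row v) i) ^+ 2).
  move=> v; apply: (@cvgN _ _ _ (nbhs v) _
    (fun v => \sum_i (x i - comb (fun_of_row v) i) ^+ 2)).
  move: v; apply: continuous_sum_row => i _ v.
  apply: (continuous_comp (f := fun v => x i - comb (fun_of_row v) i)
    (g := fun u => u ^+ 2) _ (@exprn_continuous _ 2 _)).
  exact: (@cvgB _ _ _ (nbhs v) _ (fun=> x i)
    (fun v => comb (fun_of_row v) i) _ _ (cvg_cst _) (@ccomb i v)).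
have Kc : closed (fun_of_row @^-1` K).
  rewrite (_ : _ @^-1` _ = (\bigcap_j (fun v => fun_of_row v j : R) @^-1` [set r | 0 <= r]) `&`
      (fun v => \sum_j fun_of_row v j : R) @^-1` [set r | r = 1]); last first.
    by apply/seteqP; split=> [v [v0 v1]|v [v0 v1]]; split=> // j; [move=> _|]; exact: v0.
  apply: closedI.
    apply: closed_bigI => j _; apply: (preimage_closed _ (@closed_ge _ 0)) => v _.
    exact: continuous_fun_of_row.
  apply: (preimage_closed _ (@closed_eq _ 1)) => v _.
  apply: continuous_sum_row => j _; exact: continuous_fun_of_row.
have [l [l0 l1] lmax] := compact_fun_max (ex_intro _ _ (Kj j0)) Kle1 Kc cont.
(* A defect in coordinate [i] at the optimal weights would be a positive lower bound for all squared
   distances, against [approx]. *)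
exists l; split=> // i; apply/eqP; rewrite -subr_eq0 -sqrf_eq0 eq_le sqr_ge0 andbT leNgt.
apply/negP => e0; have [_ [l' Kl' <-]] := approx _ e0; apply/negP; rewrite -leNgt.
have := lmax l' Kl'; rewrite !row_of_funK lerN2; apply: le_trans.
by rewrite [leRHS](bigD1 i)//= lerDl sumr_ge0// => k _; exact: sqr_ge0.
Qed.

(** * Finitely supported vectors and functionals *)

Lemma bounded_is_functional {R : realType} (V : normedModType R) (f : V -> R^o) (M : R) :
  linear f -> (forall x, `|f x| <= M * `|x|) -> is_functional f.
Proof.
move=> lf fM; apply/is_functionalP; split=> //.
pose g : {linear V -> R^o} := HB.pack f (GRing.isLinear.Build R V R^o _ f lf).
apply: (@bounded_linear_continuous _ _ _ g).
apply/linear_boundedP; near=> r => x; apply: le_trans (fM x) _.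
by rewrite ler_wpM2r//; near: r; apply: nbhs_pinfty_ge; exact: num_real.
Unshelve. all: by end_near. Qed.

Lemma norm_canonical_embedding {R : realType} (V : normedModType R) (x : V) :
  `|canonical_embedding x| <= `|x|.
Proof.
by apply: dual_norm_le => f f1; apply: le_trans (dual_norm_ub f x) _; rewrite ler_piMl.
Qed.

Section FiniteVectors.
Context {R : realType} {T : choiceType} (F : covering_family T).
Implicit Types (x y : T -> R^o) (c : T -> R) (V : {fset T}).

Lemma XnormP (x : Xspace R F) (M : R) :
  `|x| <= M <-> forall A, F A -> \sum_(i <- A) `|x i| <= M.
Proof.
rewrite -lee_fin (XnormE x); split=> [xM A FA|xM].
  by rewrite -lee_fin; apply: le_trans (family_norm_ub x FA) xM.
by apply: family_norm_le => A FA; rewrite lee_fin; exact: xM.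
Qed.

Lemma sum_le_Xnorm (x : Xspace R F) A : F A -> \sum_(i <- A) `|x i| <= `|x|.
Proof. by move=> FA; exact: (XnormP x _).1. Qed.

Lemma coord_le_Xnorm (x : Xspace R F) i : `|x i| <= `|x|.
Proof. by have := sum_le_Xnorm x (members1 F i); rewrite big_seq_fset1. Qed.

Lemma finite_vector_subproof V x : is_Xvector F (fun i => if i \in V then x i else 0).
Proof.
rewrite /is_Xvector inE; apply: finite_support_Xset.
apply: sub_finite_set (finite_fset V) => i /=.
by case: ifP => //; rewrite eqxx.
Qed.

Definition finite_vector V x : Xspace R F := XSpace (finite_vector_subproof V x).

Lemma finite_vectorE V x :
  finite_vector V x = \sum_(i <- V) x i *: unit_vector R F i.
Proof.
apply/val_inj/funext => j; rewrite raddf_sum fct_sumE/=.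
rewrite [RHS](eq_bigr (fun i => x i * (j == i)%:R))//.
case: ifPn => jV.
  rewrite (big_fsetD1 j jV)/= eqxx mulr1 big_seq big1 ?addr0// => i.
  by rewrite in_fsetD1 eq_sym => /andP[/negPf-> _]; rewrite mulr0.
rewrite big_seq big1// => i iV.
have [ji|_] := eqVneq j i; first by rewrite ji iV in jV.
exact: mulr0.
Qed.

Lemma functional_finite_vector (f : dual (Xspace R F)) V x :
  f (finite_vector V x) = \sum_(i <- V) x i * dual_coords f i.
Proof.
rewrite finite_vectorE linear_sum; apply: eq_bigr => i _.
by rewrite linearZ.
Qed.

Lemma Xnorm_finite_vector_le V x (M : R) :
  (forall A, F A -> \sum_(i <- A) `|x i| <= M) -> `|finite_vector V x| <= M.
Proof.
move=> xM; apply/XnormP => A FA; apply: le_trans (xM A FA).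
by apply: ler_sum => i _ /=; case: ifP => // _; rewrite normr0.
Qed.

(** This is the condition that defines the space; enlarging [V] only shrinks the tail. *)
Lemma finite_vector_approx (x : Xspace R F) (e : R) : 0 < e ->
  exists V, forall W, (V `<=` W)%fset -> `|x - finite_vector W x| <= e.
Proof.
move=> e0; have /XsetP/(_ e e0)[V xV] : Xset F x by apply/set_mem; case: x.
exists V => W /fsubsetP VW; apply/XnormP => A FA; rewrite -lee_fin.
apply: le_trans xV; apply: le_trans (family_norm_ub _ FA); rewrite lee_fin.
apply: ler_sum => i _; rewrite /coord_proj.
rewrite -[(x - _) i]/(x i - (if i \in W then x i else 0)).
case: ifPn => iW; first by rewrite subrr normr0.
by rewrite subr0 ifT// inE/= => /VW; apply/negP.
Qed.

Lemma finite_functional_subproof V c :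
  is_functional (fun x : Xspace R F => \sum_(i <- V) c i * x i : R^o).
Proof.
apply: (@bounded_is_functional _ _ _ (\sum_(i <- V) `|c i|)).
  move=> a x y; rewrite scaler_sumr -big_split/=; apply: eq_bigr => i _.
  have : c i * (a * x i + y i) = a * (c i * x i) + c i * y i by lra.
  exact.
move=> x; apply: le_trans (ler_norm_sum _ _ _) _; rewrite mulr_suml.
by apply: ler_sum => i _; rewrite normrM ler_wpM2l// coord_le_Xnorm.
Qed.

Definition finite_functional V c : dual (Xspace R F) := Dual (finite_functional_subproof V c).

Lemma sign_vector_norm (s : T -> R^o) A :
  sign_vectors R (members (perp F)) s -> F A -> \sum_(i <- A) `|s i| <= 1.
Proof.
move=> [s01 [E FE sE]] FA; apply: le_trans (_ : (\sum_(i <- A) (i \in E))%N%:R <= _).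
  rewrite natr_sum; apply: ler_sum => i _; rewrite sE.
  by have := s01 i; rewrite !inE => /or3P[]/eqP->;
    rewrite ?normrN ?normr1 ?normr0 ?oppr_eq0 ?oner_eq0 ?eqxx.
by rewrite sum_mem_fset -[leRHS]/(1%:R) ler_nat fsetIC; exact: FE.
Qed.

(** By heredity the part of the support inside [V] is itself orthogonal to [F]. *)
Lemma sign_vector_pairing V c (b : R) (s : T -> R^o) :
  (forall E, perp F E -> E `<=` V -> \sum_(i <- E) `|c i| <= b)%fset ->
  sign_vectors R (members (perp F)) s -> \sum_(i <- V) c i * s i <= b.
Proof.
move=> cb [s01 [E FE sE]].
have FEV : perp F (E `&` V)%fset by apply: members_hereditary FE; exact: fsubsetIl.
apply: le_trans (cb _ FEV (fsubsetIr _ _)).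
rewrite -(sum_fset_indic _ (fsubsetIr E V)) big_seq [leRHS]big_seq; apply: ler_sum => i iV.
rewrite inE iV andbT sE; apply: le_trans (ler_norm _) _; rewrite normrM.
have := s01 i; rewrite !inE => /or3P[]/eqP->;
  by rewrite ?normrN ?normr1 ?normr0 ?oppr_eq0 ?oner_eq0 ?eqxx.
Qed.

Lemma conv_sign_vector_norm y A :
  conv_hull (sign_vectors R (members (perp F))) y -> F A -> \sum_(i <- A) `|y i| <= 1.
Proof.
move=> Wy FA.
apply: (conv_hull_ind
  (B := [set y | \sum_(i <- A) `|y i| <= 1])) Wy => [{}y z t y1 z1 /andP[t0 t1]|s Hs]; last first.
  exact: sign_vector_norm.
apply: le_trans (_ : t * \sum_(i <- A) `|y i| + (1 - t) * \sum_(i <- A) `|z i| <= _).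
  rewrite !mulr_sumr -big_split/=; apply: ler_sum => i _.
  apply: le_trans (ler_normD _ _) _.
  by rewrite [X in X + _]normrM [X in _ + X]normrM
    (ger0_norm t0) (@ger0_norm _ (1 - t)) ?subr_ge0.
rewrite /= in y1 z1 *; nra.
Qed.

Lemma conv_sign_vector_pairing V c (b : R) y :
  (forall E, perp F E -> E `<=` V -> \sum_(i <- E) `|c i| <= b)%fset ->
  conv_hull (sign_vectors R (members (perp F))) y -> \sum_(i <- V) c i * y i <= b.
Proof.
move=> cb.
apply: (conv_hull_ind
  (B := [set y | \sum_(i <- V) c i * y i <= b])) => [{}y z t y1 z1 /andP[t0 t1]|s Hs]; last first.
  exact: sign_vector_pairing cb Hs.
have E : \sum_(i <- V) c i * (t *: y + (1 - t) *: z) i =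
    t * \sum_(i <- V) c i * y i + (1 - t) * \sum_(i <- V) c i * z i.
  rewrite !mulr_sumr -big_split/=; apply: eq_bigr => i _.
  have : c i * (t * y i + (1 - t) * z i) = t * (c i * y i) + (1 - t) * (c i * z i) by lra.
  exact.
rewrite /= in y1 z1; rewrite /mkset E; nra.
Qed.

(** Homogeneity and passage to absolute values reduce the inequality to linear forms on the unit
    ball. *)
Lemma pairing_boundI :
  (forall V (x : Xspace R F) c (b : R), unit_ball (Xspace R F) x ->
    (forall E, perp F E -> E `<=` V -> \sum_(i <- E) `|c i| <= b)%fset ->
    (forall i, i \notin V -> x i = 0) -> \sum_(i <- V) c i * x i <= b) ->
  pairing_bound R F.
Proof.
move=> H V x c a b xa cb.
have a0 : 0 <= a.
  by have := xa _ (members0 F) (fsub0set _); rewrite big_seq_fset0.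
move: a0; rewrite le_eqVlt => /predU1P[a0|a0].
  (* For [a = 0] no scaling is possible, but [x] vanishes on [V], singletons being members. *)
  rewrite -a0 mulr0 big_seq big1// => i iV.
  have := xa _ (members1 F i); rewrite fsub1set big_seq_fset1 -a0 normr_le0.
  by move=> /(_ iV)/eqP->; rewrite mulr0 normr0.
rewrite -ler_pdivrMr// mulr_suml.
have := H V (finite_vector V (fun i => a^-1 * `|x i|)) (fun i => `|c i|) b.
rewrite big_seq (eq_bigr (fun i => `|c i * x i| / a)) => [|i iV]; last first.
  by rewrite /= iV normrM; lra.
rewrite -big_seq; apply => [|E FE EV|i iV /=].
- apply/XnormP => A FA; have FAV : F (A `&` V)%fset.
    by apply: members_hereditary FA; exact: fsubsetIl.
  rewrite -(big_fset_incl _ (fsubsetIl A V)) => [|i iA]; last first.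
    by rewrite inE iA/= => /negPf->; rewrite normr0.
  apply: le_trans (_ : a^-1 * \sum_(i <- (A `&` V)%fset) `|x i| <= 1); last first.
    by rewrite mulrC ler_pdivrMr// mul1r; apply: xa => //; exact: fsubsetIr.
  rewrite mulr_sumr big_seq [leRHS]big_seq; apply: ler_sum => i.
  rewrite inE /= => /andP[_ ->]; rewrite normrM normr_id ger0_norm// invr_ge0 ltW//.
- by under eq_bigr do rewrite normr_id; exact: cb.
- by rewrite (negPf iV).
Qed.

End FiniteVectors.

(** * The unit ball as a hull of sign vectors *)

Section HullCharacterisations.
Context {R : realType} {T : choiceType} (F : covering_family T).
Implicit Types (x y : T -> R^o) (c : T -> R) (V : {fset T}).

Lemma finite_sup_attained V c :
  exists E, [/\ perp F E, (E `<=` V)%fset &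
    forall E', perp F E' -> (E' `<=` V)%fset ->
      \sum_(i <- E') `|c i| <= \sum_(i <- E) `|c i|].
Proof.
have P0 : fset0 \in fpowerset V by rewrite fpowersetE fsub0set.
have pE0 : `[< perp F (val [` P0]%fset) >] by apply/asboolP; exact: members0.
have := @arg_maxP _ R (fpowerset V) [` P0]%fset (fun E => `[< perp F (val E) >])
  (fun E => \sum_(i <- val E) `|c i|) pE0.
case=> E /asboolP FE Emax; exists (val E); split=> //.
  by rewrite -fpowersetE; exact: valP.
move=> E' FE' E'V; have P' : E' \in fpowerset V by rewrite fpowersetE.
by have := Emax [` P']%fset; apply; apply/asboolP.
Qed.

Lemma conv_sign_vectors_c00 : conv_hull (sign_vectors R (members (perp F))) `<=` c00.
Proof.
apply: conv_hull_ind => [y z t fy fz _|s [_ [A _ sA]]].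
  apply: (@sub_finite_set _ _ ([set i | y i != 0] `|` [set i | z i != 0])).
    move=> i; rewrite /= -[(_ + _) i]/(t * y i + (1 - t) * z i).
    have [->|y0] := eqVneq (y i) 0; last by left.
    by have [->|z0] := eqVneq (z i) 0; [rewrite !mulr0 addr0 eqxx|right].
  by rewrite finite_setU.
by apply: sub_finite_set (finite_fset A) => i /=; rewrite sA.
Qed.

Lemma conv_sign_vectors_ball :
  conv_hull (sign_vectors R (members (perp F)))
    `<=` @coords R T F @` unit_ball (Xspace R F) `&` c00.
Proof.
move=> y Wy; have y00 := conv_sign_vectors_c00 Wy; split=> //.
have yX : is_Xvector F y by rewrite /is_Xvector inE; exact: finite_support_Xset.
by exists (XSpace yX) => //; apply/XnormP => A; exact: conv_sign_vector_norm.
Qed.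

(** Only the finitely many sign vectors supported in the support [V] of [x] matter. Each linear form
    has one on which it reaches its norm on [V], which dominates its value at [x]; so no form
    separates [x] from them. *)
Lemma pairing_bound_hull : pairing_bound R F ->
  @coords R T F @` unit_ball (Xspace R F) `&` c00
    = conv_hull (sign_vectors R (members (perp F))).
Proof.
move=> PF; apply/seteqP; split; last exact: conv_sign_vectors_ball.
move=> _ [[x x1 <-] /finite_fsetP[V xV]].
have x0 i : i \notin V -> x i = 0.
  by apply: contraNeq => xi; have : [set i | x i != 0] i by []; rewrite xV.
(* The index [j] is a support with a set of minus signs; a support that is not orthogonal to [F] is
   assigned the zero vector, itself a sign vector. *)
pose s (j : fpowerset V * fpowerset V) : T -> R^o := fun t =>
  if `[< perp F (val j.1) >] && (t \in val j.1) then (-1) ^+ (t \in val j.2) else 0.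
have P0 : fset0 \in fpowerset V by rewrite fpowersetE fsub0set.
have [|l [l0 l1 xl]] := @finite_combination R V _ (fun j i => s j (val i))
    (fun i => x (val i)) ([` P0], [` P0])%fset.
  move=> c; pose d t : R := if insub t is Some i then c i else 0.
  have dE (i : V) : d (val i) = c i by rewrite /d valK.
  have [E [FE EV Emax]] := finite_sup_attained V d.
  have PE : E \in fpowerset V by rewrite fpowersetE.
  (* The signs follow those of the form, whose value becomes the sum of [|d|] over [E]. *)
  pose N := [fset t in V | d t < 0]%fset.
  have PN : N \in fpowerset V.
    by rewrite fpowersetE; apply/fsubsetP => t; rewrite !inE => /andP[].
  exists ([` PE], [` PN])%fset.
  under eq_bigr do rewrite -dE; under [leRHS]eq_bigr do rewrite -dE.
  rewrite -(big_seq_fsetE _ V predT (fun t => d t * x t)).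
  rewrite -(big_seq_fsetE _ V predT (fun t => d t * s ([` PE], [` PN])%fset t))/=.
  apply: le_trans (_ : \sum_(t <- V) `|d t * x t| <= _).
    by apply: ler_sum => t _; exact: ler_norm.
  rewrite (_ : \sum_(t <- V) d t * s _ t = \sum_(t <- E) `|d t|).
    rewrite -[leRHS]mulr1; apply: PF => [A FA _|]; first exact: (XnormP x 1).1.
    exact: Emax.
  rewrite -(sum_fset_indic _ EV) !big_seq; apply: eq_bigr => t tV.
  rewrite /s/= (asboolT FE)/=; case: ifPn => tE; last by rewrite !mulr0.
  rewrite mulr1 !inE/= tV/=; case: (ltrP (d t) 0) => dt.
    by rewrite ltr0_norm// expr1 mulrN1.
  by rewrite expr0 mulr1 ger0_norm.
have -> : (x : T -> R^o) = (\sum_j l j)^-1 *: \sum_j l j *: s j.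
  rewrite l1 invr1 scale1r; apply/funext => t; rewrite fct_sumE.
  have [tV|tV] := boolP (t \in V); first exact: (xl [` tV]%fset).
  rewrite x0// big1// => j _.
  rewrite -[_ t]/(l j * s j t) /s [t \in val j.1](_ : _ = false) ?andbF ?mulr0//.
  apply: contraNF tV; apply/fsubsetP; rewrite -fpowersetE; exact: valP.
apply: conv_hull_sum => // [j|]; last by rewrite l1.
split=> [t|].
  rewrite /s; case: ifP => _; last by rewrite !inE eqxx orbT.
  by case: (t \in _); rewrite ?expr1 ?expr0 !inE eqxx ?orbT.
exists (if `[< perp F (val j.1) >] then val j.1 else fset0).
  by case: asboolP => // _; exact: members0.
move=> t; rewrite /s; case: asboolP => /= _; last by rewrite eqxx.
by case: (t \in val j.1); rewrite ?eqxx// signr_eq0.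
Qed.

(** [coords] is linear and injective, so hulls may be taken among all functions or within the space;
    the next lemma is the converse. *)
Lemma Xsign_vectors_hull (x : Xspace R F) :
  conv_hull (sign_vectors R (members (perp F))) x ->
  conv_hull (Xsign_vectors R F (members (perp F))) x.
Proof.
rewrite -(range_Xsign_vectors R F).
have -> : [set (z : T -> R^o) | z in Xsign_vectors R F (members (perp F))] =
    @coords R T F @` Xsign_vectors R F (members (perp F)) by [].
rewrite -image_conv_hull// => -[y Wy yx].
by have /val_inj <- : \val y = \val x.
Qed.

Lemma hull_Xsign_vectors (x : Xspace R F) :
  conv_hull (Xsign_vectors R F (members (perp F))) x ->
  conv_hull (sign_vectors R (members (perp F))) x.
Proof.
move=> Wx; rewrite -(range_Xsign_vectors R F).
have -> : [set (z : T -> R^o) | z in Xsign_vectors R F (members (perp F))] =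
    @coords R T F @` Xsign_vectors R F (members (perp F)) by [].
by rewrite -image_conv_hull//; exists x.
Qed.

Lemma hull_unit_ball :
  conv_hull (Xsign_vectors R F (members (perp F))) `<=` unit_ball (Xspace R F).
Proof.
move=> x /hull_Xsign_vectors Wx; apply/XnormP => A; exact: conv_sign_vector_norm.
Qed.

Lemma closed_unit_ball (V : normedModType R) : closed (unit_ball V).
Proof.
apply: (preimage_closed _ (@closed_le R 1)) => x _; exact: norm_continuous.
Qed.

(** Truncations of a vector of the ball remain in the ball, hence lie in the hull, and approximate
    the vector in norm. *)
Lemma hull_closure :
  @coords R T F @` unit_ball (Xspace R F) `&` c00
    = conv_hull (sign_vectors R (members (perp F))) ->
  unit_ball (Xspace R F) = closure (conv_hull (Xsign_vectors R F (members (perp F)))).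
Proof.
move=> H2; apply/seteqP; split=> [x x1|]; last first.
  by move=> x /(closure_subset hull_unit_ball); exact: closed_unit_ball.
move=> B /nbhs_ballP[e /= e0 eB].
have [V /(_ V (fsubset_refl V)) xV] := finite_vector_approx x (divr_gt0 e0 (ltr0Sn _ 1)).
exists (finite_vector F V x); split; last first.
  by apply: eB; rewrite -ball_normE/=; apply: le_lt_trans xV _;
    rewrite ltr_pdivrMr// ltr_pMr// ltr1n.
apply: Xsign_vectors_hull; rewrite -H2; split.
  exists (finite_vector F V x) => //; apply: Xnorm_finite_vector_le => A FA.
  exact: (XnormP x 1).1.
by apply: sub_finite_set (finite_fset V) => i /=; case: ifP => //; rewrite eqxx.
Qed.

End HullCharacterisations.

(** * The weak* topology of the bidual *)

Section WeakStar.
Context {R : realType} (V : normedModType R).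
Implicit Types (A : set (dual V)) (f g : dual V).

Lemma weak_star_eval_continuous (x : V) :
  continuous (fun f : weak_star V => (f : dual V) x : R^o).
Proof.
move=> f.
have cf : {for f, continuous (@functional R V : weak_star V -> {ptws V -> R^o})}.
  exact: initial_continuous.
have cp : {for functional f, continuous ((fun h => h x) : {ptws V -> R^o} -> R^o)}.
  exact: (@proj_continuous V (fun=> R^o) x).
exact: continuous_comp cf cp.
Qed.

Lemma weak_star_closure_sub A (x : V) (B : set R) :
  closed B -> A `<=` [set f | B (f x)] -> weak_star_closure A `<=` [set f | B (f x)].
Proof.
move=> Bc AB; have Cc : closed ([set f | B ((f : dual V) x)] : set (weak_star V)).
  apply: (@preimage_closed (weak_star V) R^o (fun f => (f : dual V) x) B _ Bc).
  move=> f _; exact: weak_star_eval_continuous.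
by move=> f Af; apply: Cc; exact: (@closure_subset (weak_star V) _ _ AB).
Qed.

(** The sets of functionals within [e] of [f] at finitely many points generate a filter converging
    pointwise to [f], so each weak* neighbourhood of [f] contains one of them. *)
Lemma weak_star_closureP A f :
  (forall (r : seq V) (e : R), 0 < e ->
     exists2 g, A g & forall x, x \in r -> `|f x - g x| < e) ->
  weak_star_closure A f.
Proof.
move=> fA B [_ [[U Uo <-] /= Uf] UB].
pose D := [set p : seq V * R | 0 < p.2].
pose N (p : seq V * R) := [set g : dual V | forall x, x \in p.1 -> `|f x - g x| < p.2].
have FF : Filter (filter_from D N).
  apply: filter_from_filter; first by exists ([::], 1); exact: ltr01.
  move=> [r d] [s e] /= d0 e0; exists (r ++ s, Num.min d e).
    by rewrite /D/= lt_min d0 e0.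
  move=> g Ng; split=> x xr; have := Ng x;
    rewrite /= mem_cat xr ?orbT lt_min => /(_ isT)/andP[]//.
have FU : (@functional R V @ filter_from D N) U.
  have : {ptws, (@functional R V @ filter_from D N) --> (functional f)}.
    apply/(@pointwise_cvgP V R^o) => x; apply/cvgrPdist_lt => e e0.
    exists ([:: x], e) => // g Ng /=; apply: Ng; exact: mem_head.
  by apply; apply: open_nbhs_nbhs.
have [[r e] e0 NU] := FU; have [g Ag gf] := fA r e e0.
by exists g; split=> //; apply: UB; exact: NU.
Qed.

Lemma weak_star_closed_unit_ball A :
  A `<=` unit_ball (dual V) -> weak_star_closure A `<=` unit_ball (dual V).
Proof.
move=> A1 f Af; apply: dual_norm_le => x x1.
apply: (@weak_star_closure_sub A x [set r : R | `|r| <= 1] _ _ f Af).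
  apply: (preimage_closed _ (@closed_le R 1)) => y _; exact: norm_continuous.
move=> g /A1 g1 /=; apply: le_trans (dual_norm_ub g x) _.
by apply: mulr_ile1 => //; exact: normr_ge0 g.
Qed.

End WeakStar.

Lemma image_canonical_embedding {R : realType} (V : normedModType R) (A : set V) :
  @canonical_embedding R V @` conv_hull A = conv_hull (@canonical_embedding R V @` A).
Proof.
apply: image_conv_hull => x y t; apply/val_inj/funext => f /=.
by rewrite linearD !linearZ.
Qed.

(* Goldstine's theorem for a convex set that is norm dense in the ball: in the
   finitely many coordinates of a weak* neighbourhood, a point of the bidual
   ball cannot be separated from the image of the convex set. *)
Lemma bidual_ball_weak_star_closure {R : realType} (V : normedModType R) (A : set V) :
  unit_ball V = closure (conv_hull A) -> A !=set0 ->
  unit_ball (dual (dual V)) =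
    weak_star_closure (conv_hull (@canonical_embedding R V @` A)).
Proof.
move=> BA [a0 Aa0]; have A1 : conv_hull A `<=` unit_ball V.
  by rewrite BA; exact: subset_closure.
rewrite -image_canonical_embedding; apply/seteqP; split=> [phi phi1|]; last first.
  apply: weak_star_closed_unit_ball => _ [x /A1 x1 <-].
  exact: le_trans (norm_canonical_embedding x) x1.
apply: weak_star_closureP => r e e0.
pose f (i : 'I_(size r)) : dual V := tnth (in_tuple r) i.
pose ev (x : V) : 'I_(size r) -> R^o := fun i => f i x.
have hull0 : conv_hull A a0 by exact: sub_conv_hull.
have [||||_ [x Ax <-] xe] := @convex_approx R _ [set ev x | x in conv_hull A]
    (fun i => phi (f i)) (\sum_i (`|f i| + `|f i|) ^+ 2) _ _ _ _ (e ^+ 2) (exprn_gt0 2 e0).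
- move=> _ _ t [x Ax <-] [y Ay <-] t01.
  exists (t *: x + (1 - t) *: y); first exact: conv_hull_convex.
  by apply/funext => i; rewrite /ev linearD !linearZ.
- by exists (ev a0), a0.
- move=> _ _ [x /A1 x1 <-] [y /A1 y1 <-]; apply: ler_sum => i _.
  rewrite -[leLHS]real_normK ?num_real// lerXn2r ?nnegrE ?addr_ge0 ?(normr_ge0 (f i))//.
  apply: le_trans (ler_normB _ _) _; apply: lerD.
    by apply: le_trans (dual_norm_ub (f i) x) _; rewrite ler_piMr ?(normr_ge0 (f i)).
  by apply: le_trans (dual_norm_ub (f i) y) _; rewrite ler_piMr ?(normr_ge0 (f i)).
(* A linear form in the coordinates is evaluation at one functional [h]. Its bound [d] on the hull
   extends by density to the ball, hence to the norm of [h] and to [phi h]. *)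
- move=> c d cd; pose h : dual V := \sum_i c i *: f i.
  have hE x : h x = \sum_i c i * f i x.
    rewrite /h -[LHS]/(canonical_embedding x (\sum_i c i *: f i)) linear_sum.
    by apply: eq_bigr => i _; rewrite linearZ.
  have hd x : unit_ball V x -> h x <= d.
    have hc : closed [set x | h x <= d].
      by apply: (preimage_closed _ (@closed_le R d)) => y _; exact: (dual_continuous (f := h)).
    rewrite BA => Ax; apply: hc; apply: (closure_subset _ Ax) => y Ay /=.
    by rewrite hE; apply: cd; exists y.
  have h1 : `|h| <= d.
    apply: dual_norm_le => x x1; rewrite ler_norml hd// andbT lerNl.
    by rewrite -linearN; apply: hd; rewrite /unit_ball/= normrN.
  have -> : \sum_i c i * phi (f i) = phi h.
    by rewrite /h linear_sum; apply: eq_bigr => i _; rewrite linearZ.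
  apply: le_trans (ler_norm _) _; apply: le_trans (dual_norm_ub phi h) _.
  by apply: le_trans h1; rewrite ler_piMl// (normr_ge0 h).
exists (canonical_embedding x); first by exists x.
move=> g gr; have /tnthP[i ->] : g \in in_tuple r by [].
rewrite -ltr_sqr// ?nnegrE ?(ltW e0)// real_normK ?num_real//.
apply: le_lt_trans xe; rewrite (bigD1 i)//= lerDl sumr_ge0// => k _; exact: sqr_ge0.
Qed.

(** Evaluation at a finitely supported functional is weak* continuous, so its bound on the hull of
    the sign vectors holds on the closure, in particular at the image of [x]. *)
Lemma weak_star_pairing_bound {R : realType} {T : choiceType} (F : covering_family T) :
  unit_ball (dual (dual (Xspace R F))) = weak_star_closure (conv_hull
    (@canonical_embedding R (Xspace R F) @` Xsign_vectors R F (members (perp F)))) ->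
  pairing_bound R F.
Proof.
move=> H4; apply: pairing_boundI => V x c b x1 cb _.
have : unit_ball (dual (dual (Xspace R F))) (canonical_embedding x).
  exact: le_trans (norm_canonical_embedding x) x1.
rewrite H4 -image_canonical_embedding.
move=> /(weak_star_closure_sub (x := finite_functional F V c) (@closed_le R b)); apply.
by move=> _ [y /hull_Xsign_vectors Wy <-]; exact: conv_sign_vector_pairing cb Wy.
Qed.

Lemma zero_Xsign_vector {R : realType} {T : choiceType} (F H : covering_family T) :
  Xsign_vectors R F (members H) 0.
Proof.
split=> [i|]; first by rewrite !inE eqxx orbT.
by exists fset0 => [|i]; [exact: members0|rewrite /= eqxx].
Qed.

(** * Extreme points *)

Section ExtremePoints.
Context {R : realType}.

(** Over a finite carrier every function belongs to the space, and the ball is closed and,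
    singletons being members, bounded. *)
Lemma extreme_unit_ball_maximizer {T : finType} (F : covering_family T) (c : T -> R) :
  exists2 x, extreme_points (unit_ball (Xspace R F)) x &
    forall y, unit_ball (Xspace R F) y -> \sum_i c i * y i <= \sum_i c i * x i.
Proof.
have XT (y : T -> R^o) : is_Xvector F y.
  by rewrite /is_Xvector inE; apply: finite_support_Xset; exact: finite_finset.
pose K : set (T -> R^o) := [set y | forall A, F A -> \sum_(i <- A) `|y i| <= 1].
have KE (y : T -> R^o) : K y <-> unit_ball (Xspace R F) (XSpace (XT y)).
  by split=> [Ky|/XnormP //]; apply/XnormP.
have [|||x [Kx xext] xmax] := @extreme_maximizer R T K c 1.
- by exists (0 : T -> R^o) => A _; rewrite big1// => i _; rewrite normr0.
- by move=> y i /(_ _ (members1 F i)); rewrite big_seq_fset1.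
- rewrite (_ : _ @^-1` _ = \bigcap_(A in members F)
      ((fun v => \sum_(i <- A) `|fun_of_row v i| : R) @^-1` [set r | r <= 1])); last first.
    by apply/seteqP; split=> v Kv A; exact: Kv.
  apply: closed_bigI => A _; apply: (preimage_closed _ (@closed_le R 1)) => v _.
  apply: continuous_sum_row => i _ w.
  exact: (continuous_comp (@continuous_fun_of_row R T i w) (@norm_continuous _ R _)).
exists (XSpace (XT x)).
  split; first exact/KE.
  move=> y z t y1 z1 t01 xE; apply/val_inj/(xext _ _ t) => //=.
  - exact: (XnormP y 1).1.
  - exact: (XnormP z 1).1.
  - exact: (congr1 val xE).
by move=> y y1; apply: xmax; exact: (XnormP y 1).1.
Qed.

(** Otherwise [j] could be added to [A] without losing orthogonality. *)
Lemma maximal_perp_witness {T : choiceType} (F : covering_family T) (A : {fset T}) (j : T) :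
  max_members (members (perp F)) A -> j \notin A ->
  exists2 i, i \in A & F [fset i; j]%fset.
Proof.
move=> [FA Amax] jA; apply: contrapT => H.
suff /Amax/(_ (fsubsetU1 j A)) AE : perp F (j |` A)%fset.
  by rewrite AE !inE eqxx in jA.
move=> B FB; apply/cardfs_le1 => u v; rewrite !inE => /andP[uA uB] /andP[vA vB].
have noj i : i \in A -> i \in B -> j \in B -> False.
  move=> iA iB jB; apply: H; exists i => //; apply: members_hereditary FB.
  by apply/fsubsetP => k /fset2P[]->.
case/predU1P: uA uB => [->|uA] uB; case/predU1P: vA vB => [->|vA] vB //.
- by have := noj v vA vB uB.
- by have := noj u uA uB vB.
- by apply: (cardfs_le1 _ (FA B FB)); rewrite inE ?uA ?vA.
Qed.

Lemma sign_abs (s : R) : s \in [:: -1; 0; 1] -> s != 0 -> `|s| = 1.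
Proof. by rewrite !inE => /or3P[]/eqP->; rewrite ?normrN ?normr1 ?eqxx. Qed.

Lemma extreme_points_hull {T : finType} (F : covering_family T) :
  @coords R T F @` unit_ball (Xspace R F) `&` c00
    = conv_hull (sign_vectors R (members (perp F))) ->
  @coords R T F @` extreme_points (unit_ball (Xspace R F))
    = sign_vectors R (max_members (members (perp F))).
Proof.
move=> H2; have XT (y : T -> R^o) : is_Xvector F y.
  by rewrite /is_Xvector inE; apply: finite_support_Xset; exact: finite_finset.
have {H2}ballE (y : Xspace R F) : unit_ball (Xspace R F) y <->
    conv_hull (sign_vectors R (members (perp F))) y.
  rewrite -H2; split=> [y1|[[z z1 zy] _]]; last by have /val_inj <- : \val z = \val y.
  by split; [exists y|exact: finite_finset].
apply/seteqP; split=> [_ [x [x1 xext] <-]|s [s01 [A mA sA]]].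
  have [x01 [A FA xA]] : sign_vectors R (members (perp F)) x.
    apply: extreme_points_conv_hull; split; first exact/ballE.
    move=> y z t Wy Wz t01 xE.
    have [y1 z1] : unit_ball _ (XSpace (XT y)) /\ unit_ball _ (XSpace (XT z)).
      by split; exact/ballE.
    have xE' : x = t *: XSpace (XT y) + (1 - t) *: XSpace (XT z) by exact/val_inj.
    exact: (congr1 val (xext _ _ t y1 z1 t01 xE')).
  split=> //; exists A => //; split=> // B FB AB; apply/eqP; rewrite eqEfsubset AB/=.
  apply: contraT => /fsubsetPn[i iB iA].
  have xi : x i = 0 by apply/eqP; apply: contraNT iA; rewrite xA.
  (* Adding [i] to [A] stays inside [B], so moving [x] by 1 either way along [i] gives sign vectors
     of the ball with midpoint [x]. *)
  have ball_pm (e : R) : e \in [:: -1; 0; 1] -> e != 0 ->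
      unit_ball (Xspace R F) (x + e *: unit_vector R F i).
    move=> e01 e0; apply/XnormP => C FC; apply: (@sign_vector_norm R T F) FC.
    have xeE j : (x + e *: unit_vector R F i) j = if j == i then e else x j.
      rewrite -[LHS]/(x j + e * (j == i)%:R); have [->|_] := eqVneq j i.
        by rewrite xi add0r mulr1.
      by rewrite mulr0 addr0.
    split=> [j|]; first by rewrite xeE; case: ifP.
    exists (i |` A)%fset => [|j].
      by apply: members_hereditary FB; rewrite fsubUset fsub1set iB.
    by rewrite xeE !inE xA; case: eqP => //= _; rewrite e0.
  have b1 := ball_pm 1 _ (oner_neq0 R); rewrite !inE eqxx !orbT in b1.
  have b2 := ball_pm (-1) _ _; rewrite !inE eqxx oppr_eq0 oner_eq0 in b2.
  have := xext _ _ (2^-1) (b1 isT) (b2 isT isT).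
  have -> : 0 < (2^-1 : R) < 1 by rewrite invr_gt0 ltr0n invf_lt1// ltr1n.
  have xE : x = 2^-1 *: (x + 1 *: unit_vector R F i) +
    (1 - 2^-1) *: (x + -1 *: unit_vector R F i).
    have -> : 1 - 2^-1 = 2^-1 :> R by lra.
    rewrite -scalerDr scaleN1r scale1r addrACA subrr addr0 -mulr2n -(scaler_nat 2 x) scalerA.
    by rewrite mulVf ?scale1r// pnatr_eq0.
  move=> /(_ isT xE) /addrI /(congr1 (fun u : Xspace R F => u i)).
  rewrite -[LHS]/(1 * (i == i)%:R) -[RHS]/(-1 * (i == i)%:R) eqxx !mulr1.
  by move=> /eqP; rewrite -subr_eq0 opprK -[_ + _]/(2%:R) pnatr_eq0.
have s1 : sign_vectors R (members (perp F)) s by split=> //; exists A => //; case: mA.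
exists (XSpace (XT s)) => //; split; first by apply/ballE; exact: sub_conv_hull.
move=> y z t y1 z1 /andP[t0 t1] sE.
have {}sE i : s i = t * y i + (1 - t) * z i by exact: (congr1 (fun u : Xspace R F => u i) sE).
(* On its support [s] takes the values 1 and -1, the end points of the range allowed to [y] and
   [z]. *)
have yA i : i \in A -> y i = s i /\ z i = s i.
  rewrite sA => si; have := sign_abs (s01 i) si.
  have := le_trans (coord_le_Xnorm y i) y1; have := le_trans (coord_le_Xnorm z i) z1.
  have := s01 i; rewrite !ler_norml => si01 /andP[zl zu] /andP[yl yu] _.
  move: si si01 (sE i); rewrite !inE => /negPf->; rewrite /= => /orP[]/eqP-> E.
    by split; nra.
  by split; nra.
(* Off the support, [j] shares a member with some [i] in [A] where [u] already has absolute value 1,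
   so nothing is left for [u j]. *)
have off (u : Xspace R F) j : unit_ball _ u -> (forall i, i \in A -> u i = s i) ->
    j \notin A -> u j = 0.
  move=> u1 uA jA; have [i iA Fij] := maximal_perp_witness mA jA.
  have := (XnormP u 1).1 u1 _ Fij.
  rewrite big_fsetU1 ?inE/=; last by apply: contraNneq jA => <-.
  rewrite big_seq_fset1 uA// sign_abs ?s01 -?sA// => uj.
  by apply/eqP; rewrite -normr_le0; lra.
apply/val_inj/funext => j /=; have [/yA[-> ->]//|jA] := boolP (j \in A).
by rewrite !off// => i /yA[].
Qed.

(** * Restriction to a finite set of points *)

Section Restriction.
Context {T : choiceType} (F : covering_family T) (V : {fset T}) (V0 : V != fset0).

Lemma fset_val_image (A : {fset T}) : (A `<=` V)%fset ->
  exists B : {fset V}, A = [fset val i | i in B]%fset.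
Proof.
move=> /fsubsetP AV; exists [fset i : V | val i \in A]%fset; apply/fsetP => t.
apply/idP/imfsetP => [tA|[i /=]]; last by rewrite !inE => iA ->.
by exists [` AV t tA]%fset; rewrite ?inE.
Qed.

Lemma sum_val_image (B : {fset V}) (f : T -> R) :
  \sum_(t <- [fset val i | i in B]%fset) f t = \sum_(i <- B) f (val i).
Proof. by rewrite big_imfset//= => i j _ _; exact: val_inj. Qed.

(** Against sets inside [V], a member of [F] may be replaced by its part inside [V]. *)
Lemma perp_restriction :
  members (perp (restriction F V0)) = members (restriction (perp F) V0).
Proof.
apply/seteqP; split=> A FA B FB; apply/cardfs_le1.
  move=> _ _ /fsetIP[/imfsetP[i /= iA ->] iB] /fsetIP[/imfsetP[j /= jA ->] jB].
  congr val; have [C BC] := fset_val_image (fsubsetIr B V).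
  have RC : restriction F V0 C.
    by rewrite /= /restriction_members/= -BC; apply: members_hereditary FB; exact: fsubsetIl.
  have inC k : val k \in B -> k \in C.
    move=> kB; have : val k \in [fset val i | i in C]%fset by rewrite -BC inE kB fsvalP.
    by move=> /imfsetP[l /= lC /val_inj->].
  by apply: (cardfs_le1 _ (FA C RC)); rewrite inE ?iA ?jA inC.
move=> i j /fsetIP[iA iB] /fsetIP[jA jB]; apply: val_inj.
by apply: (cardfs_le1 _ (FA _ FB)); rewrite inE !in_imfset.
Qed.

(** Vectors are extended by 0 off [V]; the bound for [F] tests only sets inside the image of [W],
    and these come from the restricted families. *)
Lemma pairing_bound_restriction :
  pairing_bound R F -> pairing_bound R (restriction F V0).
Proof.
move=> PF W x c a b xa cb.
pose ext (y : V -> R) t := if insub t is Some i then y i else 0.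
have extE y i : ext y (val i) = y i by rewrite /ext valK.
have WV : ([fset val i | i in W] `<=` V)%fset.
  by apply/fsubsetP => _ /imfsetP[i _ ->]; exact: fsvalP.
have subW B : ([fset val i | i in B] `<=` [fset val i | i in W] -> B `<=` W)%fset.
  move=> /fsubsetP BW; apply/fsubsetP => i iB.
  by have /imfsetP[j /= jW /val_inj->] : val i \in [fset val i | i in W]%fset by rewrite BW// in_imfset.
have := PF [fset val i | i in W]%fset (ext x) (ext c) a b.
rewrite sum_val_image; under eq_bigr do rewrite !extE.
apply=> E FE EW; have [B EB] := fset_val_image (fsubset_trans EW WV);
  rewrite EB sum_val_image; under eq_bigr do rewrite extE.
- by apply: xa; [rewrite /= /restriction_members/= -EB|apply: subW; rewrite -EB].
- apply: cb; last by apply: subW; rewrite -EB.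
  by rewrite perp_restriction /= /restriction_members/= -EB.
Qed.

End Restriction.

Lemma pairing_bound_extreme_points {T : choiceType} (F : covering_family T) (V : {fset T})
    (V0 : V != fset0) :
  pairing_bound R F ->
  @coords R V (restriction F V0) @`
      extreme_points (unit_ball (Xspace R (restriction F V0)))
    = sign_vectors R (max_members (members (restriction (perp F) V0))).
Proof.
move=> /(@pairing_bound_restriction _ _ V V0)/pairing_bound_hull/extreme_points_hull.
by rewrite perp_restriction.
Qed.

(** A linear form on the finite-dimensional ball is maximal at an extreme point, which is a sign
    vector and therefore gives at most [b]. *)
Lemma extreme_points_pairing_bound {T : choiceType} (F : covering_family T) :
  (forall (V : {fset T}) (V0 : V != fset0),
    @coords R V (restriction F V0) @`
        extreme_points (unit_ball (Xspace R (restriction F V0)))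
      = sign_vectors R (max_members (members (restriction (perp F) V0)))) ->
  pairing_bound R F.
Proof.
move=> H1; apply: pairing_boundI => V x c b x1 cb xV.
have [VE|V0] := eqVneq V fset0.
  rewrite VE big_seq_fset0; have := cb _ (members0 (perp F)) (fsub0set _).
  by rewrite big_seq_fset0.
have [y yext ymax] := extreme_unit_ball_maximizer (restriction F V0) (fun i => c (val i)).
have : sign_vectors R (max_members (members (restriction (perp F) V0))) y.
  by rewrite -H1; exists y.
rewrite -(perp_restriction F V0) => -[y01 [A [FA _] yA]].
have yb : \sum_i c (val i) * y i <= b.
  have -> : \sum_i c (val i) * y i = \sum_(i <- [fset i : V | true]%fset) c (val i) * y i.
    apply: perm_big; apply: uniq_perm; rewrite ?index_enum_uniq ?fset_uniq// => i.
    by rewrite mem_index_enum !inE.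
  apply: (@sign_vector_pairing R V (restriction F V0)); last by split=> //; exists A.
  move=> E; rewrite perp_restriction => FE _;
    rewrite -(sum_val_image E (fun t => `|c t|)); apply: cb => //.
  by apply/fsubsetP => _ /imfsetP[i _ ->]; exact: fsvalP.
apply: le_trans yb; rewrite big_seq_fsetE/=.
have xX : is_Xvector (restriction F V0) (fun i => x (val i)).
  by rewrite /is_Xvector inE; apply: finite_support_Xset; exact: finite_finset.
have := ymax (XSpace xX); apply; apply/XnormP => B RB.
by have := (XnormP x 1).1 x1 _ RB; rewrite sum_val_image.
Qed.

End ExtremePoints.

(** * Geometric duals *)

Section GeometricDuals.
Context {R : realType}.

(** [f] is tested on the sign pattern of its coordinates on [A], a vector of norm at most 1 because
    [A] meets each member of [H] at most once. *)
Lemma family_norm_dual_coords {T : choiceType} (F H : covering_family T)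
    (f : dual (Xspace R H)) :
  (forall A E, F A -> H E -> #|` A `&` E| <= 1)%fset%N ->
  (family_norm F (dual_coords f) <= `|f|%:E)%E.
Proof.
move=> FH; apply: family_norm_le => A FA; rewrite lee_fin.
pose s i : R^o := Num.sg (dual_coords f i).
have -> : \sum_(i <- A) `|dual_coords f i| = f (finite_vector H A s).
  by rewrite functional_finite_vector; apply: eq_bigr => i _; rewrite /s -normrEsg.
apply: le_trans (ler_norm _) _; apply: le_trans (dual_norm_ub f _) _.
rewrite ler_piMr ?(normr_ge0 f)//; apply/XnormP => E HE.
apply: le_trans (_ : (\sum_(i <- E) (i \in A))%N%:R <= _).
  rewrite natr_sum; apply: ler_sum => i _ /=; case: ifP => _; last by rewrite normr0.
  by rewrite /s normr_sg; case: (_ != 0).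
by rewrite sum_mem_fset -[leRHS]/(1%:R) ler_nat fsetIC; exact: FH.
Qed.

(** Keeping two families apart lets this form of the pairing inequality serve a family and its
    orthogonal family in either order. *)
Definition dual_pairing {T : choiceType} (F H : covering_family T) : Prop :=
  forall (V : {fset T}) (x : Xspace R H) (y : T -> R^o) (M : R),
    (family_norm F y <= M%:E)%E -> \sum_(i <- V) `|y i * x i| <= M * `|x|.

Lemma dual_norm_coords {T : choiceType} (F H : covering_family T)
    (f : dual (Xspace R H)) (M : R) :
  dual_pairing F H -> (family_norm F (dual_coords f) <= M%:E)%E -> `|f| <= M.
Proof.
move=> FH fM; apply: dual_norm_le => x x1; apply/ler_addgt0Pr => e e0.
have M0 : 0 <= M by rewrite -lee_fin; apply: le_trans fM; exact: family_norm_ge0.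
(* Adding 1 keeps the divisor positive when [f] is 0. *)
have f1 : 0 < `|f| + 1 by rewrite ltr_wpDl// (normr_ge0 f).
have [V /(_ V (fsubset_refl V)) xV] := finite_vector_approx x (divr_gt0 e0 f1).
have -> : f x = f (finite_vector H V x) + f (x - finite_vector H V x).
  by rewrite -linearD addrC subrK.
apply: le_trans (ler_normD _ _) _; apply: lerD.
  rewrite functional_finite_vector; apply: le_trans (ler_norm_sum _ _ _) _.
  apply: le_trans (_ : M * `|x| <= _); last by rewrite ler_piMr.
  by rewrite (eq_bigr _ (fun i _ => congr1 Num.norm (mulrC _ _))); exact: FH.
apply: le_trans (dual_norm_ub f _) _.
apply: le_trans (ler_wpM2l (normr_ge0 f) xV) _.
by rewrite mulrCA ler_piMr ?(ltW e0)// ler_pdivrMr// mul1r lerDl.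
Qed.

(** * The functional of pairing with a fixed sequence *)

Section Functional.
Variables (F H : covering_family nat) (y : nat -> R^o) (M : R).
Hypotheses (FH : dual_pairing F H) (yM : (family_norm F y <= M%:E)%E).

(** On the carrier [nat] the pairing is an ordered series, absolutely convergent by the bound on
    finite sums. *)
Let term (x : Xspace R H) : R^o ^nat := fun i => y i * x i.

Lemma sum_term_le (x : Xspace R H) n : \sum_(0 <= i < n) `|term x i| <= M * `|x|.
Proof.
have := FH [fset i in iota 0 n]%fset x yM; apply: le_trans.
rewrite le_eqVlt; apply/orP; left; apply/eqP/perm_big/uniq_perm;
  rewrite ?iota_uniq ?fset_uniq//.
by move=> i; rewrite /index_iota subn0 !inE.
Qed.

Lemma cvg_term (x : Xspace R H) : cvgn (series (term x)).
Proof.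
apply: normed_cvg; apply: nondecreasing_is_cvgn.
  by apply: nondecreasing_series => n _ _; exact: normr_ge0.
by exists (M * `|x|) => _ [n _ <-]; exact: sum_term_le.
Qed.

Lemma pairing_functional_subproof :
  is_functional (fun x : Xspace R H => limn (series (term x)) : R^o).
Proof.
apply: (@bounded_is_functional _ _ _ M) => [a x x'|x].
  have -> : series (term (a *: x + x')) = a *: series (term x) + series (term x').
    apply/funext => n; rewrite !fctE /series/= scaler_sumr -big_split/=.
    apply: eq_bigr => i _.
    have : y i * (a * x i + x' i) = a * (y i * x i) + y i * x' i by lra.
    exact.
  apply/cvg_lim => //; apply: cvgD; last exact: cvg_term.
  by apply: cvgZl_tmp; exact: cvg_term.
have cn : `|series (term x) n| @[n --> \oo] --> (`|limn (series (term x))| : R).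
  exact: cvg_norm (@cvg_term x).
rewrite -(cvg_lim _ cn)//; apply: limr_le; first exact: cvgP cn.
by apply: nearW => n /=; apply: le_trans (ler_norm_sum _ _ _) _; exact: sum_term_le.
Qed.

Definition pairing_functional : dual (Xspace R H) := Dual pairing_functional_subproof.

Lemma dual_coords_pairing_functional : dual_coords pairing_functional = y.
Proof.
apply/funext => n; rewrite /dual_coords/=.
(* A partial sum over [i < k] contains the index [n] exactly from [k = n.+1] on. *)
apply/cvg_lim => //; apply: (@cvg_near_cst _ _ _ _ _); exists n.+1 => //= k nk.
rewrite /series/= (bigD1_seq n)/= ?iota_uniq ?mem_index_iota//.
rewrite /term/= eqxx mulr1 big1 ?addr0// => i /negPf->; exact: mulr0.
Qed.

End Functional.

(** Orthogonality bounds the norm of the coordinates by that of the functional; the pairing gives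
    the reverse bound and turns each [y] of finite norm into a functional. *)
Lemma dual_pairing_geometric_dual (F H : covering_family nat) :
  (forall A E, F A -> H E -> #|` A `&` E| <= 1)%fset%N ->
  dual_pairing F H -> geometric_dual R F H.
Proof.
move=> ort FH; split.
  apply/seteqP; split=> [y yF|_ [f _ <-]].
    have yM : (family_norm F y <= (fine (family_norm F y))%:E)%E.
      by rewrite fineK// ge0_fin_numE ?family_norm_ge0.
    by exists (pairing_functional FH yM) => //; exact: dual_coords_pairing_functional.
  by apply: le_lt_trans (family_norm_dual_coords f ort) (ltry _).
move=> f; apply/le_anti; rewrite (family_norm_dual_coords f ort)/=.
have ffin : family_norm F (dual_coords f) \is a fin_num.
  rewrite ge0_fin_numE ?family_norm_ge0//.
  exact: le_lt_trans (family_norm_dual_coords f ort) (ltry _).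
rewrite -(fineK ffin) lee_fin; apply: (dual_norm_coords FH).
by rewrite fineK.
Qed.

(** Swapping the factors of each product exchanges the two families, so one inequality yields both
    dualities. *)
Lemma pairing_bound_geometric_duals (F : covering_family nat) :
  pairing_bound R F -> geometric_duals R F (perp F).
Proof.
move=> PF; split; apply: dual_pairing_geometric_dual.
- by move=> A E FA; rewrite fsetIC; exact.
- move=> V x y M yM; rewrite mulrC (eq_bigr _ (fun i _ => congr1 Num.norm (mulrC _ _))).
  apply: PF => [A FA _|E FE _]; last exact: sum_le_Xnorm.
  by rewrite -lee_fin; apply: le_trans yM; exact: family_norm_ub.
- by move=> A E FA FE; exact: FA.
- move=> V x y M yM; apply: PF => [A FA _|E FE _]; first exact: sum_le_Xnorm.
  by rewrite -lee_fin; apply: le_trans yM; exact: (@family_norm_ub _ _ (perp F)).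
Qed.

(** A vector [x] of the ball is the coordinate sequence of a functional of norm at most 1 on the
    space of [perp F], where [c] truncated to [V] has norm at most [b]; the pairing is the value of
    one at the other. *)
Lemma geometric_dual_pairing_bound {T : choiceType} (F : covering_family T) :
  geometric_dual R F (perp F) -> pairing_bound R F.
Proof.
move=> [YF normF]; apply: pairing_boundI => V x c b x1 cb xV.
have : Yset (R := R) F x by apply: Xset_Yset; apply/set_mem; case: x {x1 xV}.
rewrite YF => -[f _ fx].
have f1 : `|f| <= 1 by rewrite -lee_fin -normF fx -XnormE lee_fin.
have -> : \sum_(i <- V) c i * x i = f (finite_vector (perp F) V c).
  by rewrite functional_finite_vector fx.
have b0 : 0 <= b.
  by have := cb _ (members0 (perp F)) (fsub0set _); rewrite big_seq_fset0.
apply: le_trans (ler_norm _) _; apply: le_trans (dual_norm_ub f _) _.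
apply: le_trans (ler_wpM2r (normr_ge0 _) f1) _; rewrite mul1r.
apply/XnormP => E FE; have FEV : perp F (E `&` V)%fset.
  by apply: members_hereditary FE; exact: fsubsetIl.
apply: le_trans (cb _ FEV (fsubsetIr _ _)).
rewrite -(big_fset_incl _ (fsubsetIl E V)) => [|i iE]; last first.
  by rewrite inE iE/= => /negPf->; rewrite normr0.
by rewrite big_seq [leRHS]big_seq; apply: ler_sum => i; rewrite inE /= => /andP[_ ->].
Qed.

End GeometricDuals.

Theorem theorem4p6 (R : realType) (F : covering_family nat) :
  [<->
    geometric_duals R F (perp F);

    forall (V : {fset nat}) (V0 : V != fset0),
      @coords R V (restriction F V0) @`
        extreme_points (unit_ball (Xspace R (restriction F V0)))
      = sign_vectors R (max_members (members (restriction (perp F) V0)));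

    (@coords R nat F @` unit_ball (Xspace R F)) `&` c00
      = conv_hull (sign_vectors R (members (perp F)));

    unit_ball (Xspace R F)
      = closure (conv_hull (Xsign_vectors R F (members (perp F))));

    unit_ball (dual (dual (Xspace R F)))
      = weak_star_closure (conv_hull
          (@canonical_embedding R (Xspace R F) @`
             Xsign_vectors R F (members (perp F))));

    exists2 G : graph nat, perfect G & members F = cliques G
  ].
Proof.
(* The implications form a cycle in the listed order. Density arguments lead from (2) to (3) and on
   to (4); the other four steps pass through the pairing inequality. *)
tfae.
- by case=> /geometric_dual_pairing_bound PF _ V V0; exact: pairing_bound_extreme_points.
- by move=> /extreme_points_pairing_bound/pairing_bound_hull.
- exact: hull_closure.
- move=> H3; apply: bidual_ball_weak_star_closure => //.
  by exists 0; exact: zero_Xsign_vector.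
- move=> /weak_star_pairing_bound PF; exists (pair_graph F).
    exact: pairing_bound_perfect PF.
  exact: pairing_bound_cliques PF.
- move=> [G pG FG]; apply: pairing_bound_geometric_duals.
  exact: perfect_pairing_bound pG FG.
Qed.
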